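(* Let $R$ be a commutative Noetherian local ring which is a complete intersection. Then the following are equivalent. (1) $R$ is an Artinian hypersurface. (2) $\operatorname{mod} R$ has only trivial extension-closed subcategories.
   Context: A local ring $R$ is a complete intersection if its completion is isomorphic to a regular local ring modulo a regular sequence. An Artinian hypersurface is an Artinian local ring that is a hypersurface; equivalently, a ring isomorphic to $S/(x^n)$ for some discrete valuation ring $S$ with maximal ideal $(x)$ and some integer $n\ge 1$. $\operatorname{mod} R$ is the category of finitely generated $R$-modules. A subcategory of $\operatorname{mod} R$ always means a nonempty full subcategory closed under isomorphism. A subcategory is extension-closed if it is closed under direct summands and closed under extensions (for every exact sequence $0\to L\to M\to N\to 0$ in $\operatorname{mod} R$ with $L,N$ in the subcategory, $M$ is also in it). The trivial extension-closed subcategories are: the one consisting of zero modules, the one consisting of all finitely generated free $R$-modules, and $\operatorname{mod} R$ itself. $\operatorname{mod} R$ has only trivial extension-closed subcategories if every extension-closed subcategory is one of these three. *)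

(* Defs.v *)
From HB Require Import structures.
From mathcomp Require Import all_boot all_order all_algebra.
From mathcomp Require Import ring_quotient.
From mathcomp Require Import boolp.

Set Implicit Arguments.
Unset Strict Implicit.
Unset Printing Implicit Defensive.

Import GRing.Theory.
Local Open Scope ring_scope.
Local Open Scope quotient_scope.

(* All rings are commutative with 1 != 0.  An element of [idealr R] is a
   proper ideal; boolean membership is no restriction, as Prop-valued
   predicates are reflected into bool with [`[< _ >]]. *)

Definition in_span (R : comNzRingType) (V : lmodType R) (s : seq V) (x : V) :
    Prop :=
  exists c : 'I_(size s) -> R, x = \sum_(i < size s) c i *: s`_i.

Definition ideal_spanned (R : comNzRingType) (I : idealr R) (s : seq R) : Prop :=
  forall x : R, x \in I <-> @in_span R R^o s x.

(* Restricting to proper ideals is harmless: the unit ideal is generated by 1,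
   and it can only occur as an initial segment of a descending chain. *)
Definition noetherian (R : comNzRingType) : Prop :=
  forall I : idealr R, exists s : seq R, ideal_spanned I s.

Definition artinian (R : comNzRingType) : Prop :=
  forall I : nat -> idealr R,
    (forall n, {subset I n.+1 <= I n}) ->
    exists N, forall n, (N <= n)%N -> I n =i I N.

Definition maximal_ideal (R : comNzRingType) (m : idealr R) : Prop :=
  forall I : idealr R, {subset m <= I} -> I =i m.

Definition local_ring (R : comNzRingType) (m : idealr R) : Prop :=
  maximal_ideal m /\ (forall m' : idealr R, maximal_ideal m' -> m' =i m).

Definition prime_chain (R : comNzRingType) (d : nat) : Prop :=
  exists P : nat -> prime_idealr R,
    forall i, (i < d)%N ->
      {subset P i <= P i.+1} /\ ~ {subset P i.+1 <= P i}.

Definition krull_dim (R : comNzRingType) (d : nat) : Prop :=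
  prime_chain R d /\ ~ prime_chain R d.+1.

Definition regular_local_ring (R : comNzRingType) (m : idealr R) : Prop :=
  [/\ noetherian R, local_ring m &
      exists s : seq R, ideal_spanned m s /\ krull_dim R (size s)].

Definition regular_sequence (R : comNzRingType) (s : seq R) : Prop :=
  (forall i, (i < size s)%N -> forall x : R,
     @in_span R R^o (take i s) (s`_i * x) -> @in_span R R^o (take i s) x) /\
  ~ @in_span R R^o s 1.

Definition ring_iso (A B : comNzRingType) : Prop :=
  exists f : {rmorphism A -> B}, bijective f.

Section IdealProduct.
Variables (R : comNzRingType) (I J : idealr R).

Definition ideal_mul (x : R) : bool :=
  `[< exists s : seq (R * R),
        (forall p, p \in s -> p.1 \in I /\ p.2 \in J) /\
        x = \sum_(p <- s) p.1 * p.2 >].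

Lemma ideal_mul_closed : idealr_closed ideal_mul.
Proof.
split.
- by apply/asboolP; exists [::]; rewrite big_nil; split.
- apply/negP => /asboolP[s [sIJ one]].
  have : 1 \in I.
    rewrite one big_seq; apply: rpred_sum => p /sIJ[pI _].
    by rewrite mulrC; apply: idealMr.
  by rewrite idealr1.
- move=> a u v /asboolP[s [sIJ ->]] /asboolP[t [tIJ ->]]; apply/asboolP.
  exists ([seq (a * p.1, p.2) | p <- s] ++ t); split.
    move=> p; rewrite mem_cat => /orP[/mapP[q /sIJ[qI qJ] ->]|/tIJ //].
    by split=> //=; apply: idealMr.
  rewrite big_cat big_map mulr_sumr /=; congr (_ + _).
  by apply: eq_bigr => p _; rewrite mulrA.
Qed.

HB.instance Definition _ := isIdealr.Build R ideal_mul ideal_mul_closed.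
End IdealProduct.

(* [ideal_exp m n] is m^(n+1); m^0 is omitted since it is not proper. *)
Fixpoint ideal_exp (R : comNzRingType) (m : idealr R) (n : nat) : idealr R :=
  if n is n'.+1 then ideal_mul m (ideal_exp m n') else m.

Section Completion.
Variables (R : comNzRingType) (m : idealr R).

Definition adic_quot (n : nat) : comNzRingType := {ideal_quot (ideal_exp m n)}.

(* The ring of all families in the product of the R/m^(n+1). *)
Definition adic_prod : Type := forall n, adic_quot n.

HB.instance Definition _ := gen_eqMixin adic_prod.
HB.instance Definition _ := gen_choiceMixin adic_prod.

Definition adic_zero : adic_prod := fun=> 0.
Definition adic_one : adic_prod := fun=> 1.
Definition adic_opp (f : adic_prod) : adic_prod := fun n => - f n.
Definition adic_add (f g : adic_prod) : adic_prod := fun n => f n + g n.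
Definition adic_mul (f g : adic_prod) : adic_prod := fun n => f n * g n.

Fact adic_addA : associative adic_add.
Proof. by move=> f g h; apply: functional_extensionality_dep => n; apply: addrA. Qed.
Fact adic_addC : commutative adic_add.
Proof. by move=> f g; apply: functional_extensionality_dep => n; apply: addrC. Qed.
Fact adic_add0 : left_id adic_zero adic_add.
Proof. by move=> f; apply: functional_extensionality_dep => n; apply: add0r. Qed.
Fact adic_addN : left_inverse adic_zero adic_opp adic_add.
Proof. by move=> f; apply: functional_extensionality_dep => n; apply: addNr. Qed.

HB.instance Definition _ :=
  GRing.isZmodule.Build adic_prod adic_addA adic_addC adic_add0 adic_addN.

Fact adic_mulA : associative adic_mul.
Proof. by move=> f g h; apply: functional_extensionality_dep => n; apply: mulrA. Qed.
Fact adic_mulC : commutative adic_mul.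
Proof. by move=> f g; apply: functional_extensionality_dep => n; apply: mulrC. Qed.
Fact adic_mul1 : left_id adic_one adic_mul.
Proof. by move=> f; apply: functional_extensionality_dep => n; apply: mul1r. Qed.
Fact adic_mulDl : left_distributive adic_mul +%R.
Proof. by move=> f g h; apply: functional_extensionality_dep => n; apply: mulrDl. Qed.
Fact adic_oner_neq0 : adic_one != 0.
Proof.
apply/eqP => /(congr1 (fun f : adic_prod => f 0%N)) /eqP.
by apply/negP; apply: (oner_neq0 (adic_quot 0)).
Qed.

HB.instance Definition _ := GRing.Zmodule_isComNzRing.Build adic_prod
  adic_mulA adic_mulC adic_mul1 adic_mulDl adic_oner_neq0.

(* The transition map R/m^(n+2) -> R/m^(n+1). *)
Definition adic_trans (n : nat) (x : adic_quot n.+1) : adic_quot n :=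
  \pi_(adic_quot n) (repr x).

Lemma adic_trans_pi (n : nat) (r : R) :
  adic_trans (\pi_(adic_quot n.+1) r) = \pi_(adic_quot n) r.
Proof.
rewrite /adic_trans; apply/eqP; rewrite -Quotient.idealrBE.
have : repr (\pi_(adic_quot n.+1) r) - r \in ideal_exp m n.+1.
  by rewrite Quotient.idealrBE; apply/eqP; rewrite reprK.
move=> /asboolP[s [sI ->]]; rewrite big_seq; apply: rpred_sum => p /sI[_ pJ].
exact: idealMr.
Qed.

Definition adic_coherent (f : adic_prod) : bool :=
  `[< forall n, adic_trans (f n.+1) = f n >].

Lemma adic_coherent_closed : subring_closed adic_coherent.
Proof.
split.
- apply/asboolP => n; change (adic_trans (1 : adic_quot n.+1) = 1).
  by rewrite -(rmorph1 \pi_(adic_quot n.+1)) adic_trans_pi rmorph1.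
- move=> f g /asboolP fc /asboolP gc; apply/asboolP => n.
  change (adic_trans (f n.+1 - g n.+1) = f n - g n).
  rewrite -(fc n) -(gc n) -[f n.+1]reprK -[g n.+1]reprK -rmorphB !adic_trans_pi.
  by rewrite rmorphB.
- move=> f g /asboolP fc /asboolP gc; apply/asboolP => n.
  change (adic_trans (f n.+1 * g n.+1) = f n * g n).
  rewrite -(fc n) -(gc n) -[f n.+1]reprK -[g n.+1]reprK -rmorphM !adic_trans_pi.
  by rewrite rmorphM.
Qed.

HB.instance Definition _ :=
  GRing.isSubringClosed.Build adic_prod adic_coherent adic_coherent_closed.

(* The m-adic completion, as the inverse limit of the rings R/m^(n+1). *)
Record completion : Type := Completion {
  completion_val : adic_prod;
  completion_valP : adic_coherent completion_val
}.

HB.instance Definition _ := [isSub for completion_val].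
HB.instance Definition _ := [Choice of completion by <:].
HB.instance Definition _ := [SubChoice_isSubComNzRing of completion by <:].

End Completion.

Definition complete_intersection (R : comNzRingType) (m : idealr R) : Prop :=
  exists (S : comNzRingType) (n : idealr S) (s : seq S) (I : idealr S),
    [/\ regular_local_ring n, regular_sequence s, ideal_spanned I s &
        ring_iso (completion m) {ideal_quot I}].

(* f = 0 is allowed, so that regular local rings count as hypersurfaces. *)
Definition hypersurface (R : comNzRingType) (m : idealr R) : Prop :=
  exists (S : comNzRingType) (n : idealr S) (f : S) (I : idealr S),
    [/\ regular_local_ring n, ideal_spanned I [:: f] &
        ring_iso (completion m) {ideal_quot I}].

Definition artinian_hypersurface (R : comNzRingType) (m : idealr R) : Prop :=
  [/\ artinian R, local_ring m & hypersurface m].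

Section Modules.
Variable R : comNzRingType.

Definition mod_iso (M N : lmodType R) : Prop :=
  exists f : {linear M -> N}, bijective f.

Definition fin_gen (M : lmodType R) : Prop :=
  exists s : seq M, forall x : M, in_span s x.

Definition zero_module (M : lmodType R) : Prop := forall x : M, x = 0.

Definition fin_free (M : lmodType R) : Prop :=
  exists n : nat, mod_iso 'rV[R]_n M.

Definition short_exact (L M N : lmodType R)
    (f : {linear L -> M}) (g : {linear M -> N}) : Prop :=
  [/\ injective f,
      forall y : M, g y = 0 <-> exists x : L, f x = y &
      forall z : N, exists y : M, g y = z].

(* Full subcategories of mod R are given by their classes of objects. *)
Definition subcategory (X : lmodType R -> Prop) : Prop :=
  [/\ exists M, X M,
      forall M, X M -> fin_gen M &
      forall M N, mod_iso M N -> X M -> X N].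

Definition summand_closed (X : lmodType R -> Prop) : Prop :=
  forall M N : lmodType R, X (M * N)%type -> X M.

Definition extension_closed (X : lmodType R -> Prop) : Prop :=
  [/\ subcategory X,
      summand_closed X &
      forall (L M N : lmodType R) (f : {linear L -> M}) (g : {linear M -> N}),
        fin_gen M -> short_exact f g -> X L -> X N -> X M].

Definition trivial_subcategory (X : lmodType R -> Prop) : Prop :=
  [\/ forall M, X M <-> zero_module M,
      forall M, X M <-> fin_free M |
      forall M, X M <-> fin_gen M].

Definition only_trivial_extension_closed : Prop :=
  forall X : lmodType R -> Prop, extension_closed X -> trivial_subcategory X.

End Modules.

(* Main.v *)
(* (1) => (2).  By Krull's principal ideal theorem an Artinian quotient S/(f) of
   a regular local ring forces dim S <= 1, so the maximal ideal of R is (x) with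
   x^n = 0 and every finitely generated module is a sum of modules R/(x^a).  The
   sequences 0 -> R/x^a -> R/x^(a-1) + R/x^(a+1) -> R/x^a -> 0 show that an
   extension-closed subcategory containing one R/(x^a) with 0 < a < n contains
   all of them.

   (2) => (1).  The modules killed by a power of the maximal ideal m form an
   extension-closed subcategory, so m is nilpotent and R is its own completion
   S/(s_1, ..., s_c).  A relation outside the square of the maximal ideal of S
   can be moved to the front of the regular sequence and killed, keeping S
   regular.  Once all relations lie in that square, either c <= 1, or the last
   two relations have matrix factorisations A B = f and C D = g with entries in
   the maximal ideal.  Then Tor_1(coker A, coker C) = 0 over R, and the vanishing
   of Tor_1(coker A, -) defines an extension-closed subcategory which contains
   the non-free module coker C but not R/m. *)
Require Import Defs.
From HB Require Import structures.
From mathcomp Require Import all_boot all_order all_algebra.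
From mathcomp Require Import ring_quotient boolp ring.

Set Implicit Arguments.
Unset Strict Implicit.
Unset Printing Implicit Defensive.

Import GRing.Theory.
Local Open Scope ring_scope.
Local Open Scope quotient_scope.

(** * Ideals as predicates and Krull's principal ideal theorem *)

(** Localisation and Tor occur only in elementary form. An ideal of the localisation at a prime W is
    represented by its contraction [saturation W I], so Krull's theorem and Nakayama's lemma become
    statements about predicates on one ring. Tor_1(coker A, -) is the middle homology of a pair of
    square matrices. Relations are pushed into the square of the maximal ideal because a
    factorisation A B = f with entries in the maximal ideal exists exactly for such f. Entries of
    this kind act as zero on R/m, so R/m has nonzero homology, and they keep coker C from being
    free. The homology vanishes on coker C because the errors made in lifting a cycle from R to S
    are multiples of f and g: A B = f and D C = g absorb them, and regularity then allows f to be
    cancelled. Moving a relation to the front needs regular sequences to be permutable, which over a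
    Noetherian local ring is Nakayama's lemma again. *)

Section Spans.
Variables (R : comNzRingType) (V : lmodType R).
Implicit Types (x a : V) (s : seq V).

Lemma in_span_nil x : in_span [::] x <-> x = 0.
Proof.
split=> [[c ->]|->]; first by rewrite big_ord0.
by exists (fun=> 0); rewrite big_ord0.
Qed.

Lemma in_span_cons a s x :
  in_span (a :: s) x <-> exists r, in_span s (x - r *: a).
Proof.
split=> [[c ->]|[r [c hc]]].
  exists (c ord0), (fun i => c (lift ord0 i)); rewrite big_ord_recl /=.
  by rewrite addrAC subrr add0r.
exists (fun i => if unlift ord0 i is Some j then c j else r).
rewrite big_ord_recl unlift_none /=.
under eq_bigr => i _ do rewrite liftK.
by rewrite -[LHS](subrK (r *: a)) hc addrC.
Qed.

End Spans.

Section Ideals.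
Variable A : comNzRingType.
Implicit Types (I J K L N W P Q : A -> Prop) (s w : seq A).

Definition is_ideal I : Prop :=
  [/\ I 0, forall x y, I x -> I y -> I (x + y) & forall a x, I x -> I (a * x)].

Definition is_prime P : Prop :=
  [/\ is_ideal P, ~ P 1 & forall a b, P (a * b) -> P a \/ P b].

Lemma is_ideal0 I : is_ideal I -> I 0. Proof. by case. Qed.
Lemma is_idealD I x y : is_ideal I -> I x -> I y -> I (x + y).
Proof. by case=> _ h _; apply: h. Qed.
Lemma is_idealMl I a x : is_ideal I -> I x -> I (a * x).
Proof. by case=> _ _; apply. Qed.
Lemma is_idealMr I a x : is_ideal I -> I x -> I (x * a).
Proof. by rewrite mulrC; apply: is_idealMl. Qed.
Lemma is_idealN I x : is_ideal I -> I x -> I (- x).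
Proof. by rewrite -mulN1r; apply: is_idealMl. Qed.
Lemma is_idealB I x y : is_ideal I -> I x -> I y -> I (x - y).
Proof. by move=> iI Ix Iy; apply: is_idealD => //; apply: is_idealN. Qed.
Lemma is_ideal_subr I x y : is_ideal I -> I y -> I (x - y) -> I x.
Proof. by move=> iI Iy Ixy; rewrite -(subrK y x); apply: is_idealD. Qed.

Lemma prime_ideal P : is_prime P -> is_ideal P. Proof. by case. Qed.
Lemma prime_neq1 P : is_prime P -> ~ P 1. Proof. by case. Qed.
Lemma prime_mulN P a b : is_prime P -> ~ P a -> ~ P b -> ~ P (a * b).
Proof. by case=> _ _ h na nb /h[]. Qed.
Lemma prime_cancel P a b : is_prime P -> ~ P a -> P (a * b) -> P b.
Proof. by case=> _ _ h na /h[]. Qed.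
Lemma prime_expr P a k : is_prime P -> P (a ^+ k) -> P a.
Proof.
case=> _ P1 h; elim: k => [|k IH]; first by rewrite expr0 => /P1.
by rewrite exprS => /h[].
Qed.

Definition zero_ideal : A -> Prop := fun x => x = 0.

Lemma zero_is_ideal : is_ideal zero_ideal.
Proof.
by split=> // [x y -> ->|a x ->]; rewrite ?addr0 ?mulr0.
Qed.

Definition principal x : A -> Prop := fun y => exists c, y = c * x.

Lemma principal_ideal x : is_ideal (principal x).
Proof.
split; first by exists 0; rewrite mul0r.
  by move=> _ _ [c ->] [d ->]; exists (c + d); rewrite mulrDl.
by move=> a _ [c ->]; exists (a * c); rewrite mulrA.
Qed.

Lemma principal_id x : principal x x.
Proof. by exists 1; rewrite mul1r. Qed.

Definition sum_ideal I J : A -> Prop :=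
  fun x => exists a b, [/\ I a, J b & x = a + b].

Lemma sum_is_ideal I J : is_ideal I -> is_ideal J -> is_ideal (sum_ideal I J).
Proof.
move=> iI iJ; split.
- by exists 0, 0; rewrite addr0; split=> //; apply: is_ideal0.
- move=> _ _ [a [b [Ia Jb ->]]] [c [d [Ic Jd ->]]].
  by exists (a + c), (b + d); split; [apply: is_idealD|apply: is_idealD|ring].
- move=> r _ [a [b [Ia Jb ->]]].
  by exists (r * a), (r * b); split; [apply: is_idealMl|apply: is_idealMl|ring].
Qed.

Lemma sum_ideal_l I J x : is_ideal J -> I x -> sum_ideal I J x.
Proof. by move=> iJ Ix; exists x, 0; rewrite addr0; split=> //; apply: is_ideal0. Qed.
Lemma sum_ideal_r I J x : is_ideal I -> J x -> sum_ideal I J x.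
Proof. by move=> iI Jx; exists 0, x; rewrite add0r; split=> //; apply: is_ideal0. Qed.

(* N + K L *)
Definition prod_add K L N : A -> Prop := fun x =>
  forall I, is_ideal I -> (forall y, N y -> I y) ->
    (forall a b, K a -> L b -> I (a * b)) -> I x.

Lemma prod_add_ideal K L N : is_ideal (prod_add K L N).
Proof.
split; first by move=> I iI _ _; apply: is_ideal0.
  by move=> x y hx hy I iI h1 h2; apply: is_idealD => //; [apply: hx|apply: hy].
by move=> a x hx I iI h1 h2; apply: is_idealMl => //; apply: hx.
Qed.

(* N + K s_1 + ... + K s_r *)
Fixpoint span_with N K s (x : A) : Prop :=
  if s is a :: s' then exists r, K r /\ span_with N K s' (x - r * a) else N x.

Definition add_span N s := span_with N (fun=> True) s.

Lemma span_with_ideal N K s :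
  is_ideal N -> is_ideal K -> is_ideal (span_with N K s).
Proof.
move=> iN iK; elim: s => //= a s IH; split.
- exists 0; rewrite mul0r subr0; split; exact: is_ideal0.
- move=> x y [r [Kr hr]] [t [Kt ht]]; exists (r + t); split; first exact: is_idealD.
  have -> : x + y - (r + t) * a = (x - r * a) + (y - t * a) by ring.
  exact: is_idealD.
- move=> b x [r [Kr hr]]; exists (b * r); split; first exact: is_idealMl.
  have -> : b * x - b * r * a = b * (x - r * a) by ring.
  exact: is_idealMl.
Qed.

Lemma add_span_ideal N s : is_ideal N -> is_ideal (add_span N s).
Proof. by move=> iN; apply: span_with_ideal. Qed.

Lemma span_with_base N K s x : is_ideal K -> N x -> span_with N K s x.
Proof.
move=> iK Nx; elim: s => //= a s IH; exists 0.
by rewrite mul0r subr0; split=> //; apply: is_ideal0.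
Qed.

Lemma span_with_mem N K s a r :
  is_ideal N -> is_ideal K -> a \in s -> K r -> span_with N K s (r * a).
Proof.
move=> iN iK; elim: s => //= b s IH; rewrite inE => /orP[/eqP-> Kr|ains Kr].
  by exists r; rewrite subrr; split=> //; apply: is_ideal0; apply: span_with_ideal.
exists 0; rewrite mul0r subr0; split; [exact: is_ideal0|exact: IH].
Qed.

Lemma add_span_base N s x : N x -> add_span N s x.
Proof. by apply: span_with_base. Qed.

Lemma add_span_mem N s a : is_ideal N -> a \in s -> add_span N s a.
Proof. by move=> iN ains; rewrite -(mul1r a); apply: span_with_mem. Qed.

Lemma span_with_sub N K s (I : A -> Prop) x : is_ideal I ->
  (forall y, N y -> I y) -> (forall a r, a \in s -> K r -> I (r * a)) ->
  span_with N K s x -> I x.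
Proof.
move=> iI NI; elim: s x => [|a s IH] x /= sI; first exact: NI.
move=> [r [Kr hr]]; apply: (is_ideal_subr (y := r * a)) => //.
  by apply: sI; rewrite ?mem_head.
by apply: IH hr => b t bs Kt; apply: sI; rewrite // inE bs orbT.
Qed.

Lemma add_span_sub N s (I : A -> Prop) x : is_ideal I ->
  (forall y, N y -> I y) -> (forall a, a \in s -> I a) -> add_span N s x -> I x.
Proof.
by move=> iI NI sI; apply: span_with_sub => // a r /sI Ia _; apply: is_idealMl.
Qed.

Lemma add_span_cat N s1 s2 :
  add_span N (s1 ++ s2) = add_span (add_span N s2) s1.
Proof.
elim: s1 => //= a s1 IH; apply/funext => x; apply/propext.
rewrite /add_span /= in IH *.
by split=> -[r [_ h]]; exists r; split=> //; move: h; rewrite IH.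
Qed.

Lemma in_spanE s x : @in_span A A^o s x <-> add_span zero_ideal s x.
Proof.
elim: s x => [|a s IH] x; first exact: in_span_nil.
rewrite in_span_cons; split=> [[r /IH h]|[r [_ h]]]; exists r => //.
exact/IH.
Qed.

Lemma idealr_is_ideal (I : idealr A) : is_ideal (fun x => x \in I).
Proof.
split; first exact: idealr0.
  by move=> x y; apply: rpredD.
by move=> a x; apply: idealMr.
Qed.

Lemma proper_ideal_closed I : is_ideal I -> ~ I 1 ->
  idealr_closed (fun x => `[< I x >]).
Proof.
move=> iI nI1; split; first exact: asboolT (is_ideal0 iI).
  by apply/negP => /asboolW.
move=> a u v /asboolW Iu /asboolW Iv; apply: asboolT.
by apply: is_idealD => //; apply: is_idealMl.
Qed.

Lemma idealr_of I : is_ideal I -> ~ I 1 ->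
  exists J : idealr A, forall x, x \in J <-> I x.
Proof.
move=> iI nI1.
pose fI := isIdealr.Build A (fun x => `[< I x >]) (proper_ideal_closed iI nI1).
exists (HB.pack (fun x => `[< I x >]) fI : idealr A) => x.
by split=> [/asboolW|?] //; apply: asboolT.
Qed.

Lemma noetherian_fg I : noetherian A -> is_ideal I ->
  exists s, forall x, I x <-> add_span zero_ideal s x.
Proof.
move=> noeth iI; have [I1|nI1] := pselect (I 1).
  exists [:: 1] => x; split=> _; first by exists x; rewrite mulr1 subrr.
  by rewrite -(mulr1 x); apply: is_idealMl.
have [J hJ] := idealr_of iI nI1; have [s hs] := noeth J.
by exists s => x; rewrite -in_spanE -hs hJ.
Qed.
(** A family without a maximal member yields, by dependent choice, a strictly increasing chain of
    ideals. Finitely many generators of its union lie in one term of the chain, which therefore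
    stops. *)
Lemma noetherian_max (F : (A -> Prop) -> Prop) I0 : noetherian A ->
  (forall I, F I -> is_ideal I) -> F I0 ->
  exists2 I, F I & forall J, F J -> (forall x, I x -> J x) -> forall x, J x -> I x.
Proof.
move=> noeth Fi F0; apply: contrapT => /forall2NP nomax.
have step (I : {I | F I}) :
    {J : {I | F I} | (forall x, sval I x -> sval J x) /\ ~ forall x, sval J x -> sval I x}.
  apply/cid; case: I => I FI /=; have [//|/existsNP[J]] := nomax I.
  move=> /not_implyP[FJ /not_implyP[IJ nJI]].
  by exists (exist _ J FJ).
pose c := fix c n := if n is n'.+1 then sval (step (c n')) else exist F I0 F0.
have cS n x : sval (c n) x -> sval (c n.+1) x by apply: (svalP (step (c n))).1.
have cle n k x : (n <= k)%N -> sval (c n) x -> sval (c k) x.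
  by move=> /subnK <-; elim: (k - n)%N => // d IH /IH /cS.
have ci n : is_ideal (sval (c n)) by apply: Fi; apply: svalP.
have [] := noetherian_fg (I := fun x => exists n, sval (c n) x) noeth.
  split; first by exists 0%N; apply: is_ideal0.
    move=> x y [n hn] [k hk]; exists (maxn n k); apply: is_idealD => //.
      exact: cle (leq_maxl _ _) hn.
    exact: cle (leq_maxr _ _) hk.
  by move=> a x [n hn]; exists n; apply: is_idealMl.
move=> s hs.
have [n hn] : exists n, forall a, a \in s -> sval (c n) a.
  have : forall a, a \in s -> exists n, sval (c n) a.
    by move=> a ains; apply/hs; apply: add_span_mem => //; apply: zero_is_ideal.
  elim: (s) => [|a t IH] h; first by exists 0%N.
  have [n hn] := IH (fun b bt => h b (mem_behead (s := a :: t) bt)).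
  have [k hk] := h a (mem_head _ _).
  exists (maxn n k) => b; rewrite inE => /orP[/eqP->|bt].
    exact: cle (leq_maxr _ _) hk.
  by apply: cle (leq_maxl _ _) _; apply: hn.
have [_] := svalP (step (c n)); apply => x hx.
apply: (add_span_sub (N := zero_ideal) (s := s)) => //.
  by move=> y ->; apply: is_ideal0.
by apply/hs; exists n.+1.
Qed.

(* The contraction to A of the localisation of [I] at the prime [W]. *)
Definition saturation W I : A -> Prop := fun z => exists t, ~ W t /\ I (t * z).

Lemma saturation_ideal W I :
  is_prime W -> is_ideal I -> is_ideal (saturation W I).
Proof.
move=> pW iI; have W1 := prime_neq1 pW; split.
- by exists 1; rewrite mulr0; split=> //; apply: is_ideal0.
- move=> x y [t [nt It]] [u [nu Iu]]; exists (t * u); split; first exact: prime_mulN.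
  have -> : t * u * (x + y) = u * (t * x) + t * (u * y) by ring.
  by apply: is_idealD => //; apply: is_idealMl.
- move=> a x [t [nt It]]; exists t; split=> //.
  by rewrite mulrCA; apply: is_idealMl.
Qed.

Lemma saturation_sub W I x : is_prime W -> I x -> saturation W I x.
Proof. by move=> pW Ix; exists 1; rewrite mul1r; split=> //; apply: prime_neq1. Qed.

Lemma saturation_idem W I t x : is_prime W -> ~ W t ->
  saturation W I (t * x) -> saturation W I x.
Proof.
by move=> pW nt [u [nu Iu]]; exists (u * t); rewrite -mulrA; split=> //; apply: prime_mulN.
Qed.

(** The generators are eliminated one at a time. In t a = r a + ... the coefficient r lies in K,
    hence in W, so t - r is outside W and a can be expressed through the remaining generators. *)
Lemma nakayama_seq W K N s : is_prime W -> is_ideal K -> is_ideal N ->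
  (forall x, K x -> W x) ->
  (forall a, a \in s -> saturation W (span_with N K s) a) ->
  exists t, ~ W t /\ forall a, a \in s -> N (t * a).
Proof.
move=> pW iK iN KW; elim: s => [_|a s IH hs].
  by exists 1; split=> //; apply: prime_neq1.
have iW := prime_ideal pW.
have is' := span_with_ideal s iN iK.
have [t [nt [r [Kr hr]]]] := hs a (mem_head _ _).
have nt' : ~ W (t - r).
  by move=> h; apply: nt; apply: is_ideal_subr h => //; apply: KW.
have ha : span_with N K s ((t - r) * a) by rewrite mulrBl.
have [|u [nu hu]] := IH.
  move=> b bs; have [|v [nv [q [Kq hq]]]] := hs b; first by rewrite inE bs orbT.
  exists ((t - r) * v); split; first exact: prime_mulN.
  have -> : (t - r) * v * b = (t - r) * (v * b - q * a) + q * ((t - r) * a) by ring.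
  by apply: is_idealD => //; apply: is_idealMl.
exists (u * (t - r)); split; first exact: prime_mulN.
move=> b; rewrite inE => /orP[/eqP->|bs]; last first.
  by rewrite mulrAC; apply: is_idealMr => //; apply: hu.
rewrite -mulrA; apply: (span_with_sub (I := fun x => N (u * x))) ha.
- split; first by rewrite mulr0; apply: is_ideal0.
    by move=> x y; rewrite mulrDr; apply: is_idealD.
  by move=> c x; rewrite mulrCA; apply: is_idealMl.
- by move=> y; apply: is_idealMl.
- by move=> c q cs _; rewrite mulrCA; apply: is_idealMl => //; apply: hu.
Qed.

(** Nakayama's lemma in the localisation at W: if L is locally contained in N + K L, it is locally
    contained in N. Finite generation of L provides a single denominator t. *)
Lemma nakayama W K L N : noetherian A -> is_prime W ->
  is_ideal K -> is_ideal L -> is_ideal N -> (forall x, K x -> W x) ->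
  (forall z, L z -> saturation W (prod_add K L N) z) ->
  exists t, ~ W t /\ forall z, L z -> N (t * z).
Proof.
move=> noeth pW iK iL iN KW h.
have [s hs] := noetherian_fg noeth iL.
have [|t [nt ht]] := nakayama_seq (s := s) pW iK iN KW.
  move=> a ains; have [|t [nt ht]] := h a.
    by apply/hs/add_span_mem => //; apply: zero_is_ideal.
  exists t; split=> //; apply: ht.
  - exact: span_with_ideal.
  - by move=> y; apply: span_with_base.
  - move=> b c Kb /hs; apply: (add_span_sub (I := fun x => span_with N K s (b * x))).
    + have i' := span_with_ideal s iN iK.
      split; first by rewrite mulr0; apply: is_ideal0.
        by move=> x y; rewrite mulrDr; apply: is_idealD.
      by move=> d x; rewrite mulrCA; apply: is_idealMl.
    + move=> y ->; rewrite mulr0; apply: is_ideal0; exact: span_with_ideal.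
    + by move=> d ds; apply: span_with_mem.
exists t; split=> // z /hs; apply: (add_span_sub (I := fun x => N (t * x))) => //.
- split; first by rewrite mulr0; apply: is_ideal0.
    by move=> x y; rewrite mulrDr; apply: is_idealD.
  by move=> d x; rewrite mulrCA; apply: is_idealMl.
- by move=> y ->; rewrite mulr0; apply: is_ideal0.
Qed.

Lemma colon_ideal I a : is_ideal I -> is_ideal (fun r => I (r * a)).
Proof.
move=> iI; split; first by rewrite mul0r; apply: is_ideal0.
  by move=> x y; rewrite mulrDl; apply: is_idealD.
by move=> d x; rewrite -mulrA; apply: is_idealMl.
Qed.

(** A maximal annihilator of a nonzero element of A/B is prime. It stays inside W because B is
    saturated: a multiplier outside W cannot bring a into B. *)
Lemma associated_prime W B : noetherian A -> is_prime W -> is_ideal B ->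
  (forall z, saturation W B z -> B z) -> ~ B 1 ->
  exists a, [/\ ~ B a, is_prime (fun r => B (r * a))
    & forall r, B (r * a) -> W r].
Proof.
move=> noeth pW iB satB B1.
pose F I := exists2 a, ~ B a & I = (fun r => B (r * a)).
have [||I [a na ->] amax] := @noetherian_max F (fun r => B (r * 1)) noeth.
- by move=> _ [a _ ->]; apply: colon_ideal.
- by exists 1.
exists a; split=> //.
  split; [exact: colon_ideal|by rewrite mul1r|].
  move=> b c hbc; have [hc|nc] := pselect (B (c * a)); first by right.
  left; apply: (amax (fun r => B (r * (c * a)))); first by exists (c * a).
    by move=> x hx; rewrite mulrCA; apply: is_idealMl.
  by rewrite mulrA.
move=> r hr; apply: contrapT => nr; apply: na; apply: satB.
by exists r.
Qed.

(* [W] is minimal over [J], so A_W / J_W has a finite composition series; on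
   each simple factor the chain is eventually constant. *)
Lemma dcc_at_minimal_prime W J (L : nat -> A -> Prop) :
  noetherian A -> is_prime W -> is_ideal J ->
  (forall Q, is_prime Q -> (forall x, J x -> Q x) -> (forall x, Q x -> W x) ->
     forall x, W x -> Q x) ->
  (forall i, is_ideal (L i)) -> (forall i x, L i.+1 x -> L i x) ->
  exists i, forall j z, L i z -> saturation W (sum_ideal (L j) J) z.
Proof.
move=> noeth pW iJ Wmin iL Ldec.
have Lle i j x : (i <= j)%N -> L j x -> L i x.
  by move=> /subnK <-; elim: (j - i)%N => // d IH /Ldec.
have iS j : is_ideal (saturation W (sum_ideal (L j) J)).
  by apply: saturation_ideal => //; apply: sum_is_ideal.
(* Noetherian induction replaces the composition series: [good B] says that the chain, cut down to
   B, is constant modulo J locally at W from some index on. A maximal such B turns out to contain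
   1. *)
pose good B := [/\ is_ideal B, forall x, J x -> B x,
  forall z, saturation W B z -> B z &
  exists i, forall j z, L i z -> B z -> saturation W (sum_ideal (L j) J) z].
have [||B [iB JB satB [i hi]] Bmax] := @noetherian_max good (saturation W J) noeth.
- by move=> I [].
- split; first exact: saturation_ideal.
  + by move=> x; apply: saturation_sub.
  + by move=> z [t [nt]]; apply: saturation_idem.
  + exists 0%N => j z _ [t [nt ht]]; exists t; split=> //; exact: sum_ideal_r.
have [B1|nB1] := pselect (B 1).
  exists i => j z Lz; apply: hi => //; rewrite -(mulr1 z); exact: is_idealMl.
have [a [na pa aW]] := associated_prime noeth pW iB satB nB1.
(* The associated prime B : a contains J and lies in W, so by minimality it is W. Locally at W the
   quotient B'/B is thus simple. *)
have Wa x : W x -> B (x * a).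
  by apply: (Wmin _ pa) => // y /JB; apply: is_idealMr.
have iBa := sum_is_ideal iB (principal_ideal a).
pose B' := saturation W (sum_ideal B (principal a)).
have BB' x : B x -> B' x.
  by move=> Bx; apply: saturation_sub => //; apply: sum_ideal_l => //; apply: principal_ideal.
case: na; apply: (Bmax B') => //; last first.
  by apply: saturation_sub => //; apply: sum_ideal_r => //; apply: principal_id.
split; first exact: saturation_ideal.
- by move=> x /JB/BB'.
- by move=> z [t [nt]]; apply: saturation_idem.
(* Either the chain eventually meets B' only inside B, or each L j contains some z0 that generates
   B'/B locally. In the second case subtracting a multiple of z0 moves z into B, where [hi]
   applies. *)
have [[i0 hi0]|/forallNP hno] :=
  pselect (exists i0, forall z, L i0 z -> B' z -> B z).
  exists (maxn i i0) => j z Lz B'z; apply: hi; first exact: Lle (leq_maxl _ _) Lz.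
  by apply: hi0 => //; apply: Lle (leq_maxr _ _) Lz.
exists i => j z Liz [t1 [nt1 [b1 [_ [Bb1 [r1 ->] e1]]]]].
have [z0 /not_implyP[Lz0 /not_implyP[]]] := (existsNP _).2 (hno (maxn i j)).
move=> [t [nt [b0 [_ [Bb0 [r0 ->] e0]]]]] nBz0.
have nr0 : ~ W r0.
  move=> Wr0; apply: nBz0; apply: satB; exists t; split=> //.
  by rewrite e0; apply: is_idealD => //; apply: Wa.
have Liz0 := Lle _ _ _ (leq_maxl i j) Lz0.
have Ljz0 := Lle _ _ _ (leq_maxr i j) Lz0.
have [] := hi j (r0 * t1 * z - r1 * t * z0).
- by apply: is_idealB; rewrite //; apply: is_idealMl.
- have -> : r0 * t1 * z - r1 * t * z0 = r0 * b1 - r1 * b0.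
    rewrite -!mulrA e1 e0; ring.
  by apply: is_idealB => //; apply: is_idealMl.
move=> t2 [nt2 h2]; exists (t2 * (r0 * t1)); split.
  by apply: prime_mulN => //; apply: prime_mulN.
have -> : t2 * (r0 * t1) * z =
  t2 * (r0 * t1 * z - r1 * t * z0) + t2 * r1 * t * z0 by ring.
apply: is_idealD => //; first exact: sum_is_ideal.
by apply: sum_ideal_l => //; apply: is_idealMl.
Qed.

(* The symbolic powers of [q] modulo [P]. *)
Fixpoint symbolic_power q P n : A -> Prop :=
  if n is n'.+1 then saturation q (prod_add q (symbolic_power q P n') P)
  else fun=> True.

(* Krull's principal ideal theorem, in A / P localised at [W]: if [W] were
   minimal over P + (x), the symbolic powers of [q] would stabilise modulo x,
   hence stabilise by Nakayama, and then vanish by Nakayama at [q]. *)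
Lemma krull_principal P q W x : noetherian A ->
  is_prime P -> is_prime q -> is_prime W ->
  (forall y, P y -> q y) -> (forall y, q y -> W y) ->
  ~ (forall y, q y -> P y) -> ~ (forall y, W y -> q y) -> W x ->
  exists Q, [/\ is_prime Q, forall y, P y -> Q y, Q x,
    forall y, Q y -> W y & ~ forall y, W y -> Q y].
Proof.
move=> noeth pP pq pW Pq qW nqP nWq Wx; apply: contrapT => noQ.
have [[iP iq] iW] := (prime_ideal pP, prime_ideal pq, prime_ideal pW).
have nqx : ~ q x by move=> qx; apply: noQ; exists q.
pose L := symbolic_power q P.
have iL n : is_ideal (L n).
  by case: n => // n; apply: saturation_ideal => //; apply: prod_add_ideal.
have Lcancel n t z : ~ q t -> L n (t * z) -> L n z.
  by case: n => // n; apply: saturation_idem.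
have PL n y : P y -> L n y.
  case: n => // n Py; apply: saturation_sub => //.
  by move=> I iI h _; apply: h.
have LS n y : L n.+1 y -> L n y.
  move=> [t [nt ht]]; apply: (Lcancel n t) => //; apply: ht => //.
    by move=> z; apply: PL.
  by move=> a b _; apply: is_idealMl.
pose J := sum_ideal P (principal x).
have [||||i /(_ i.+1) hi] := @dcc_at_minimal_prime W J L noeth pW.
- by apply: sum_is_ideal => //; apply: principal_ideal.
- move=> Q pQ JQ QW y Wy; apply: contrapT => nQy; apply: noQ; exists Q; split=> //.
  + by move=> z Pz; apply: JQ; apply: sum_ideal_l => //; apply: principal_ideal.
  + by apply: JQ; apply: sum_ideal_r => //; apply: principal_id.
  + by move/(_ y Wy).
- exact: iL.
- exact: LS.
have [||t [nt ht]] := nakayama noeth pW (principal_ideal x) (iL i) (iL i.+1) _ _.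
- by move=> _ [c ->]; apply: is_idealMl.
- move=> z Lz; have [t [nt [l [_ [Ll [p [_ [Pp [r ->] ->]] e]]]]]] := hi z Lz.
  exists t; split=> // I iI NI h; rewrite e addrA.
  have Llp : L i.+1 (l + p) by apply: is_idealD => //; apply: PL.
  apply: is_idealD => //; first exact: NI.
  rewrite mulrC; apply: h; first exact: principal_id.
  (* The product x r lies in L i, x is outside q, and L i is q-saturated, so r lies in L i. This
     turns L i = L i.+1 + (x) into L i = L i.+1 + x L i, locally at W. *)
  apply: (Lcancel i x) => //.
  have -> : x * r = t * z - (l + p) by rewrite e; ring.
  by apply: is_idealB => //; [apply: is_idealMl|apply: LS].
have [||u [nu hu]] := nakayama noeth pq iq (iL i) iP.
- by [].
- move=> z Lz; have /(Lcancel i.+1) : L i.+1 (t * z) by exact: ht.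
  by apply; move=> /qW.
have LP z : L i z -> P z.
  by move=> /hu; apply: prime_cancel => // /Pq.
apply: nqP => y qy; apply: (prime_expr (k := i)) => //; apply: LP.
elim: (i) => // k IH; rewrite exprS; apply: saturation_sub => //.
by move=> I iI _ h; apply: h.
Qed.

End Ideals.

(** * Local rings and chains of prime ideals *)

Section LocalRings.
Variable A : comNzRingType.
Implicit Types (I J W : A -> Prop) (s t : seq A).

Definition is_local_max W : Prop :=
  [/\ is_ideal W, ~ W 1 & forall y, ~ W y -> exists z, z * y = 1].

Lemma local_max_prime W : is_local_max W -> is_prime W.
Proof.
move=> [iW nW1 uW]; split=> // a b Wab; have [|na] := pselect (W a); first by left.
right; have [z hz] := uW _ na.
by rewrite -(mul1r b) -hz -mulrA; apply: is_idealMl.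
Qed.

Lemma local_max_saturation W I x :
  is_local_max W -> is_ideal I -> saturation W I x -> I x.
Proof.
move=> [_ _ uW] iI [t [/uW[z hz] It]].
by rewrite -(mul1r x) -hz -mulrA; apply: is_idealMl.
Qed.

Lemma prime_idealr_of P : is_prime P ->
  exists Q : prime_idealr A, forall x, x \in Q <-> P x.
Proof.
move=> [iP nP1 mP].
pose fP := isIdealr.Build A (fun x => `[< P x >]) (proper_ideal_closed iP nP1).
have cP : prime_idealr_closed (fun x => `[< P x >]).
  by move=> u v /asboolW/mP[h|h]; apply/orP; [left|right]; apply: asboolT.
pose gP := isPrimeIdealrClosed.Build A (fun x => `[< P x >]) cP.
exists (HB.pack (fun x => `[< P x >]) fP gP : prime_idealr A) => x.
by split=> [/asboolW|?] //; apply: asboolT.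
Qed.

Lemma prime_idealr_is_prime (P : prime_idealr A) : is_prime (fun x => x \in P).
Proof.
split; first exact: idealr_is_ideal.
  by rewrite idealr1.
by move=> a b; rewrite prime_idealrM => /orP.
Qed.

(** Noetherianity takes the place of Zorn's lemma: a non-unit y lies in an ideal maximal among the
    proper ones, and this ideal can only be m. *)
Lemma local_ring_is_local_max (m : idealr A) :
  noetherian A -> local_ring m -> is_local_max (fun x => x \in m).
Proof.
move=> noeth [mmax muniq]; split; [exact: idealr_is_ideal|by rewrite idealr1|].
move=> y ny; apply: contrapT => /forallNP nz.
pose F I := [/\ is_ideal I, ~ I 1 & I y].
have [|| I [iI nI1 Iy] Imax] := @noetherian_max A F (principal y) noeth.
- by move=> I [].
- split; [exact: principal_ideal| |exact: principal_id].
  by move=> [z hz]; apply: (nz z).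
have [J hJ] := idealr_of iI nI1.
apply: ny; rewrite -(muniq J); first exact/hJ.
move=> K JK x; apply/idP/idP => [Kx|/JK //]; apply/hJ.
apply: (Imax (fun x => x \in K)) => //; last by move=> z /hJ/JK.
by split; [exact: idealr_is_ideal|rewrite idealr1|apply/JK/hJ].
Qed.

Lemma local_max_proper W I x :
  is_local_max W -> is_ideal I -> ~ I 1 -> I x -> W x.
Proof.
move=> [_ _ uW] iI nI1 Ix; apply: contrapT => /uW[z hz]; apply: nI1.
by rewrite -hz; apply: is_idealMl.
Qed.

Lemma local_max_is_local_ring (m : idealr A) :
  is_local_max (fun x => x \in m) -> local_ring m.
Proof.
move=> maxm.
have sub (I : idealr A) x : x \in I -> x \in m.
  move=> Ix; apply: (local_max_proper (W := fun x => x \in m) (I := fun x => x \in I)) Ix => //.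
    exact: idealr_is_ideal.
  by rewrite idealr1.
split=> [I mI x|m' hm' x]; first by apply/idP/idP => [/sub|/mI].
by rewrite hm' // => z /sub.
Qed.

Definition is_chain d (Q : nat -> A -> Prop) : Prop :=
  (forall i, (i <= d)%N -> is_prime (Q i)) /\
  forall i, (i < d)%N ->
    (forall x, Q i x -> Q i.+1 x) /\ ~ (forall x, Q i.+1 x -> Q i x).

Lemma prime_chainE d : prime_chain A d <-> exists Q, is_chain d Q.
Proof.
split=> [[P hP]|[Q [pQ hQ]]].
  exists (fun i x => x \in P i); split=> [i _|i /hP//].
  exact: prime_idealr_is_prime.
(* Capping the index at d makes the family total, since [is_chain] says nothing beyond d. *)
have /choice[P hP] i : exists P : prime_idealr A, forall x, x \in P <-> Q (minn i d) x.
  by apply/prime_idealr_of/pQ/geq_minr.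
exists P => i id; have [h1 h2] := hQ i id.
have e1 : minn i d = i by apply/minn_idPl/ltnW.
have e2 : minn i.+1 d = i.+1 by apply/minn_idPl.
split=> [x /hP|h]; first by rewrite e1 => /h1 hx; apply/hP; rewrite e2.
apply: h2 => x hx; have /h/hP : x \in P i.+1 by apply/hP; rewrite e2.
by rewrite e1.
Qed.

Lemma is_chain_take d k Q : (k <= d)%N -> is_chain d Q -> is_chain k Q.
Proof.
move=> kd [pQ hQ]; split=> i ik; first by apply: pQ; apply: leq_trans kd.
by apply: hQ; apply: leq_trans kd.
Qed.

Lemma is_chain_rcons d Q P : is_chain d Q -> is_prime P ->
  (forall x, Q d x -> P x) -> ~ (forall x, P x -> Q d x) ->
  is_chain d.+1 (fun i => if (i <= d)%N then Q i else P).
Proof.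
move=> [pQ hQ] pP QP nPQ; split=> i; first by case: ifP => // /pQ.
rewrite ltnS => id; rewrite id; case: ltngtP id => // [id|->] _.
- exact: hQ.
- by [].
Qed.

Lemma is_chain_cons d Q P : is_chain d Q -> is_prime P ->
  (forall x, P x -> Q 0%N x) -> ~ (forall x, Q 0%N x -> P x) ->
  is_chain d.+1 (fun i => if i is i'.+1 then Q i' else P).
Proof. by move=> [pQ hQ] pP QP nPQ; split=> -[|i] //= id; [apply: pQ|apply: hQ]. Qed.

(* This is the bound dim A/(x) >= dim A - 1. *)
Lemma is_chain_through d Q x : noetherian A -> is_chain d.+1 Q -> Q d.+1 x ->
  exists Q', [/\ is_chain d Q', Q' 0%N x & Q' d = Q d.+1].
Proof.
move=> noeth; elim: d Q => [|d IH] Q cQ Qx.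
  by exists (fun=> Q 1%N); split=> //; split=> // i _; apply: cQ.1.
(* The last but one prime is traded for a prime T that contains x. Krull's theorem finds it strictly
   between Q d and Q d.+2, and the induction hypothesis then handles the chain ending in T. *)
have [T [pT QT Tx TQ [nQT nTQ]]] : exists T, [/\ is_prime T, forall y, Q d y -> T y,
    T x, forall y, T y -> Q d.+2 y &
    ~ (forall y, Q d.+2 y -> T y) /\ ~ (forall y, T y -> Q d y)].
  have [h1 h2] := cQ.2 d (leqnSn _); have [h3 h4] := cQ.2 d.+1 (leqnn _).
  have p1 := cQ.1 d.+1 (leqnSn _).
  have [Qdx|nQdx] := pselect (Q d.+1 x).
    by exists (Q d.+1); split=> //; apply: (is_chain_take (d := d.+2)).
  have pd := cQ.1 d (leq_trans (leqnSn _) (leqnSn _)).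
  have p2 := cQ.1 d.+2 (leqnn _).
  have [T [pT QT Tx TQ nQT]] := krull_principal noeth pd p1 p2 h1 h3 h2 h4 Qx.
  exists T; split=> //; split=> // h; apply: nQdx; apply: h1; exact: h.
have cT := is_chain_rcons (is_chain_take (leq_trans (leqnSn d) (leqnSn _)) cQ) pT QT nTQ.
have [|Q' [cQ' Q'x eQ']] := IH _ cT; first by rewrite ltnn.
rewrite /= ltnn in eQ'.
have [||] := is_chain_rcons cQ' (cQ.1 d.+2 (leqnn _)).
- by rewrite eQ'.
- by rewrite eQ'.
move=> c1 c2; exists (fun i => if (i <= d)%N then Q' i else Q d.+2).
by rewrite ltnn.
Qed.

(** The localisation at Q has an associated prime. It consists of zero divisors, so it misses x and
    is strictly smaller than Q. *)
Lemma prime_below_nonzero_divisor (Q : A -> Prop) x : noetherian A -> is_prime Q -> Q x ->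
  (forall y, x * y = 0 -> y = 0) ->
  exists P, [/\ is_prime P, forall y, P y -> Q y & ~ forall y, Q y -> P y].
Proof.
move=> noeth pQ Qx xreg; have i0 := zero_is_ideal A.
have [|||a [na pa aQ]] := @associated_prime A Q (saturation Q (@zero_ideal A)) noeth pQ.
- exact: saturation_ideal.
- by move=> z [t [nt]]; apply: saturation_idem.
- by move=> [t [nt]]; rewrite /zero_ideal mulr1 => t0; apply: nt; rewrite t0; exact: is_ideal0 (prime_ideal pQ).
exists (fun r => saturation Q (@zero_ideal A) (r * a)); split=> //.
move=> /(_ x Qx)[t [nt e]]; apply: na; exists t; split=> //; apply: xreg.
by rewrite mulrCA.
Qed.

End LocalRings.

(** * Regular sequences and regular local rings *)

Section SurjectiveMorphism.
Variables (A B : comNzRingType) (f : {rmorphism A -> B}).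
Hypothesis fsurj : forall y, exists x, f x = y.
Implicit Types (I J : A -> Prop) (s : seq A).

Definition image_of I : B -> Prop := fun y => exists2 x, I x & f x = y.

Lemma image_ofE I x : is_ideal I -> (forall z, f z = 0 -> I z) ->
  image_of I (f x) <-> I x.
Proof.
move=> iI kI; split=> [[z Iz e]|]; last by exists x.
by apply: (is_ideal_subr iI Iz); apply: kI; rewrite rmorphB e subrr.
Qed.

Lemma image_of_ideal I : is_ideal I -> is_ideal (image_of I).
Proof.
move=> iI; split; first by exists 0; [exact: is_ideal0|rewrite rmorph0].
  move=> _ _ [x Ix <-] [y Iy <-].
  by exists (x + y); [exact: is_idealD|rewrite rmorphD].
move=> b _ [x Ix <-]; have [a <-] := fsurj b.
by exists (a * x); [exact: is_idealMl|rewrite rmorphM].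
Qed.

Lemma image_of_prime P : is_prime P -> (forall z, f z = 0 -> P z) ->
  is_prime (image_of P).
Proof.
move=> [iP nP1 mP] kP; split; first exact: image_of_ideal.
  by rewrite -(rmorph1 f) image_ofE.
move=> a b; have [x <-] := fsurj a; have [y <-] := fsurj b.
by rewrite -rmorphM !image_ofE //; apply: mP.
Qed.

Lemma preimage_ideal (J : B -> Prop) : is_ideal J -> is_ideal (fun x => J (f x)).
Proof.
move=> iJ; split; first by rewrite rmorph0; apply: is_ideal0.
  by move=> x y; rewrite rmorphD; apply: is_idealD.
by move=> a x; rewrite rmorphM; apply: is_idealMl.
Qed.

Lemma preimage_prime (P : B -> Prop) : is_prime P -> is_prime (fun x => P (f x)).
Proof.
move=> [iP nP1 mP]; split; first exact: preimage_ideal.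
  by rewrite rmorph1.
by move=> a b; rewrite rmorphM; apply: mP.
Qed.

Lemma image_of_local_max W : is_local_max W -> (forall z, f z = 0 -> W z) ->
  is_local_max (image_of W).
Proof.
move=> [iW nW1 uW] kW; split; first exact: image_of_ideal.
  by rewrite -(rmorph1 f) image_ofE.
move=> y; have [x <-] := fsurj y; rewrite image_ofE // => /uW[z hz].
by exists (f z); rewrite -rmorphM hz rmorph1.
Qed.

Lemma add_span_map J (J' : B -> Prop) s x :
  (forall y, J y -> J' (f y)) -> add_span J s x -> add_span J' (map f s) (f x).
Proof.
move=> JJ'; rewrite /add_span; elim: s x => [|a s IH] x /=; first exact: JJ'.
by move=> [r [_ /IH h]]; exists (f r); split=> //; rewrite -rmorphM -rmorphB.
Qed.

Lemma noetherian_image : noetherian A -> noetherian B.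
Proof.
move=> noeth J; have iJ := idealr_is_ideal J.
have [s hs] := noetherian_fg noeth (preimage_ideal iJ).
exists (map f s) => y; rewrite in_spanE; split.
  have [x <-] := fsurj y => /hs.
  by apply: add_span_map => z ->; apply: rmorph0.
apply: (add_span_sub (I := fun y => y \in J)) => //.
  by move=> _ ->; apply: idealr0.
move=> _ /mapP[a ains ->]; apply/hs; apply: add_span_mem => //.
exact: zero_is_ideal.
Qed.

End SurjectiveMorphism.

Section RegularSequences.
Variable A : comNzRingType.
Implicit Types (I J W : A -> Prop) (s t : seq A).

(** Regularity modulo J. Absorbing the head into the base ideal lets inductions run from the front;
    properness of the whole ideal is treated separately. *)
Fixpoint regular_on J s : Prop :=
  if s is a :: s' then
    (forall x, J (a * x) -> J x) /\ regular_on (add_span J [:: a]) s'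
  else True.

Lemma add_span_subset J s t x : is_ideal J -> {subset s <= t} ->
  add_span J s x -> add_span J t x.
Proof.
move=> iJ st; apply: add_span_sub; first exact: add_span_ideal.
  exact: add_span_base.
by move=> a /st; apply: add_span_mem.
Qed.

Lemma add_span_eq J s t : is_ideal J -> s =i t -> add_span J s = add_span J t.
Proof.
move=> iJ st; apply/funext => x; apply/propext.
by split; apply: add_span_subset => // a; rewrite st.
Qed.

Lemma add_span_cons J a s : is_ideal J ->
  add_span (add_span J [:: a]) s = add_span J (a :: s).
Proof.
move=> iJ; rewrite -add_span_cat; apply: add_span_eq => // x.
by rewrite mem_cat !inE orbC.
Qed.

Lemma regular_sequence_on s : regular_sequence s ->
  regular_on (@zero_ideal A) s /\ ~ add_span (@zero_ideal A) s 1.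
Proof.
move=> [reg n1]; split; last by rewrite -in_spanE.
have {reg} : forall i, (i < size s)%N -> forall x,
    add_span (@zero_ideal A) (take i s) (s`_i * x) -> add_span (@zero_ideal A) (take i s) x.
  by move=> i /reg h x; rewrite -!in_spanE; apply: h.
have := zero_is_ideal A; move: (@zero_ideal A) => J.
elim: s J {n1} => //= a s IH J iJ h; split; first exact: (h 0%N).
apply: IH; first exact: add_span_ideal.
by move=> i iS x; rewrite !add_span_cons //; apply: (h i.+1).
Qed.

(** The delicate point is that b is a nonzero divisor modulo J. Regularity of a and then b gives (J
    : b) = J + a (J : b), and Nakayama's lemma with a in W gives (J : b) = J. *)
Lemma regular_on_swap W J a b s : noetherian A -> is_local_max W ->
  is_ideal J -> W a -> regular_on J [:: a, b & s] -> regular_on J [:: b, a & s].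
Proof.
move=> noeth maxW iJ Wa /= [ra [rb rs]].
have iW : is_ideal W by case: maxW.
have pW := local_max_prime maxW.
have iba : is_ideal (fun x => J (b * x)).
  split; first by rewrite mulr0; apply: is_ideal0.
    by move=> x y; rewrite mulrDr; apply: is_idealD.
  by move=> c x; rewrite mulrCA; apply: is_idealMl.
have rbJ x : J (b * x) -> J x.
  move=> Jbx; have [||t [nt ht]] := nakayama noeth pW (principal_ideal a) iba iJ.
  - by move=> _ [c ->]; apply: is_idealMl.
  - move=> z Jbz; apply: saturation_sub => // I iI JI h.
    have [|r [_ hr]] := rb z; first exact: add_span_base.
    apply: (is_ideal_subr (y := r * a)) => //; last exact: JI.
    rewrite mulrC; apply: h; first exact: principal_id.
    apply: ra; have -> : a * (b * r) = b * z - b * (z - r * a) by ring.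
    by apply: is_idealB => //; apply: is_idealMl.
  by apply: (local_max_saturation maxW iJ); exists t; split=> //; apply: ht.
split=> //; split.
  move=> x [w [_ hw]].
  have [|r [_ hr]] := rb w.
    exists x; split=> //; have -> : b * w - x * a = - (a * x - w * b) by ring.
    exact: is_idealN.
  exists r; split=> //; apply: ra.
  have -> : a * (x - r * b) = a * x - w * b + b * (w - r * a) by ring.
  by apply: is_idealD => //; apply: is_idealMl.
rewrite !add_span_cons // in rs *; rewrite (add_span_eq (t := [:: a; b])) // => x.
by rewrite !inE orbC.
Qed.

Lemma regular_on_move_front W J s a t : noetherian A -> is_local_max W ->
  is_ideal J -> (forall b, b \in s -> W b) ->
  regular_on J (s ++ a :: t) -> regular_on J (a :: s ++ t).
Proof.
move=> noeth maxW; elim: s J => //= b s IH J iJ sW [rb rs].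
have Wb : W b by apply: sW; rewrite mem_head.
have := IH _ (add_span_ideal [:: b] iJ) _ rs.
rewrite -/(regular_on J [:: a, b & s ++ t]) => h.
apply: (regular_on_swap noeth maxW iJ Wb) => /=; split=> //.
by apply: h => c cs; apply: sW; rewrite inE cs orbT.
Qed.

End RegularSequences.

Lemma regular_on_map (A B : comNzRingType) (f : {rmorphism A -> B})
    (J : A -> Prop) (J' : B -> Prop) s :
  (forall y, exists x, f x = y) -> (forall x, J x <-> J' (f x)) ->
  regular_on J s -> regular_on J' (map f s).
Proof.
move=> fsurj; elim: s J J' => //= a s IH J J' JJ' [ra rs]; split.
  by move=> y; have [x <-] := fsurj y; rewrite -rmorphM -!JJ'; apply: ra.
apply: IH rs => x; split=> [[r [_ h]]|[r [_ h]]].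
  by exists (f r); split=> //=; rewrite -rmorphM -rmorphB; apply/JJ'.
have [q e] := fsurj r; exists q; split=> //=.
by apply/JJ'; rewrite rmorphB rmorphM e.
Qed.

(** If all coefficients of x were in W, then x would lie in the square of W. A generator whose
    coefficient u is outside W can be exchanged for x once u is a unit. *)
Lemma span_exchange (A : comNzRingType) (W : A -> Prop) s x :
  is_ideal W -> (forall a, a \in s -> W a) ->
  add_span (@zero_ideal A) s x -> ~ prod_add W W (@zero_ideal A) x ->
  exists s1 a s2 u, [/\ s = s1 ++ a :: s2, ~ W u &
    add_span (@zero_ideal A) (s1 ++ s2) (x - u * a)].
Proof.
move=> iW; have i0 := zero_is_ideal A.
elim: s x => [|a s IH] x sW; first by move=> ->; case; exact: is_ideal0 (prod_add_ideal _ _ _).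
move=> [r [_ hr]] nx.
have [Wr|nWr] := pselect (W r); last by exists [::], a, s, r.
have [||| s1 [b [s2 [u [-> nu hu]]]]] := IH (x - r * a).
- by move=> b bs; apply: sW; rewrite inE bs orbT.
- exact: hr.
- move=> h; apply: nx; apply: is_ideal_subr h; first exact: prod_add_ideal.
  by move=> I iI _ hI; apply: hI => //; apply: sW; rewrite mem_head.
exists (a :: s1), b, s2, u; split=> //.
by exists r; split=> //; rewrite addrAC.
Qed.

(** Since x replaces one generator of n, the quotient needs one generator fewer. The dimension drops
    by at most one by [is_chain_through]. It drops by at least one because a chain of primes through
    x extends downwards, x being a nonzero divisor. *)
Lemma regular_local_quotient (A B : comNzRingType) (f : {rmorphism A -> B})
    (n : idealr A) x :
  (forall y, exists z, f z = y) -> (forall y, f y = 0 <-> principal x y) ->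
  regular_local_ring n -> x \in n -> (forall y, x * y = 0 -> y = 0) ->
  ~ prod_add (fun y => y \in n) (fun y => y \in n) (@zero_ideal A) x ->
  exists n' : idealr B, regular_local_ring n' /\ forall y, f y \in n' <-> y \in n.
Proof.
move=> fsurj kerf [noeth locn [t [nt [chain nchain]]]] xn xreg xn2.
pose W : A -> Prop := fun y => y \in n.
have maxn : is_local_max W := local_ring_is_local_max noeth locn.
have {}xn2 : ~ prod_add W W (@zero_ideal A) x := xn2.
have iW : is_ideal W by case: maxn.
have kW z : f z = 0 -> W z by move=> /kerf[c ->]; exact: (is_idealMl c iW xn).
have maxB := image_of_local_max fsurj maxn kW.
have [n' hn'] : exists J : idealr B, forall y, y \in J <-> image_of f W y.
  by apply: idealr_of; case: maxB.
have hW y : f y \in n' <-> W y by rewrite hn' image_ofE.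
exists n'; split=> //.
have hnt y : W y <-> add_span (@zero_ideal A) t y by rewrite -in_spanE; apply: nt.
have i0 := zero_is_ideal A; have i0B := zero_is_ideal B.
have tW a : a \in t -> W a by move=> ains; apply/hnt/add_span_mem.
have [s1 [a [s2 [u [et nu hu]]]]] := span_exchange iW tW ((hnt x).1 xn) xn2.
have [v hv] : exists v, v * u = 1 by case: maxn => _ _; apply.
have fx0 : f x = 0 by apply/kerf; apply: principal_id.
split; first exact: noetherian_image noeth.
  apply: local_max_is_local_ring.
  by have -> : (fun y => is_true (y \in n')) = image_of f W by apply/funext => y; apply/propext/hn'.
exists (map f (s1 ++ s2)); split.
  move=> y; rewrite in_spanE hn'; split.
    move=> [{}y /hnt hy <-]; move: hy.
    apply: (add_span_sub (I := fun y => add_span (@zero_ideal B) (map f (s1 ++ s2)) (f y))).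
    - by apply: (preimage_ideal f); apply: add_span_ideal.
    - by move=> z ->; rewrite rmorph0; apply: is_ideal0; apply: add_span_ideal.
    move=> b; rewrite et mem_cat inE orbCA => /orP[/eqP->|bs]; last first.
      by apply: add_span_mem => //; apply: map_f; rewrite mem_cat.
    have -> : a = v * x - v * (x - u * a) by rewrite -{1}(mul1r a) -hv; ring.
    rewrite rmorphB !rmorphM fx0 mulr0 sub0r; apply: is_idealN; first exact: add_span_ideal.
    apply: is_idealMl; first exact: add_span_ideal.
    by apply: add_span_map hu => z ->; apply: rmorph0.
  apply: add_span_sub; first by case: maxB.
    by move=> _ ->; exists 0; [exact: is_ideal0|exact: rmorph0].
  move=> _ /mapP[b bs ->]; exists b => //; apply: tW; rewrite et.
  by move: bs; rewrite !mem_cat inE => /orP[->|->]; rewrite ?orbT.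
have -> : size (map f (s1 ++ s2)) = (size t).-1.
  by rewrite size_map et !size_cat /= addnS.
have t_gt0 : (0 < size t)%N by rewrite et size_cat /= addnS.
move: chain nchain; rewrite -(prednK t_gt0) /=; set d := (size t).-1.
move=> /prime_chainE[Q cQ] nchain; split; apply/prime_chainE.
  have [cQ1 cQ2] := cQ; have [h1 h2] := cQ2 d (leqnn _).
  have QW y : Q d.+1 y -> W y.
    have [iQ nQ _] := cQ1 d.+1 (leqnn _); exact: local_max_proper.
  have h1W y : Q d y -> W y by move=> /h1/QW.
  have h2W : ~ (forall y, W y -> Q d y) by move=> h; apply: h2 => y /QW/h.
  (* The top prime is replaced by the maximal ideal, so that the chain ends in a prime containing
     x. *)
  have cW := is_chain_rcons (is_chain_take (leqnSn d) cQ) (local_max_prime maxn) h1W h2W.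
  have [|Q' [[pQ' iQ'] Q'x _]] := is_chain_through (x := x) noeth cW; first by rewrite ltnn.
  have Q'xi i : (i <= d)%N -> Q' i x.
    by elim: i => // i IH id; apply: (iQ' i id).1; apply/IH/ltnW.
  have kQ' i : (i <= d)%N -> forall z, f z = 0 -> Q' i z.
    by move=> id z /kerf[c ->]; apply: is_idealMl (Q'xi i id); case: (pQ' i id).
  have Q'E i z : (i <= d)%N -> image_of f (Q' i) (f z) <-> Q' i z.
    by move=> id; apply: image_ofE; [case: (pQ' i id)|apply: kQ'].
  exists (fun i => image_of f (Q' i)); split=> i id.
    by apply: image_of_prime => //; [apply: pQ'|apply: kQ'].
  have [g1 g2] := iQ' i id; split=> [_ [z Qz <-]|h]; first by exists z => //; apply: g1.
  apply: g2 => z Qz; apply/Q'E; first exact: ltnW.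
  by apply: h; exists z.
move=> [Q' [cQ1' cQ2']].
apply: nchain; apply/prime_chainE.
have p0 := preimage_prime f (cQ1' 0%N (leq0n _)).
have [|P [pP PQ nQP]] := prime_below_nonzero_divisor noeth p0 _ xreg.
  by rewrite fx0; exact: is_ideal0 (prime_ideal (cQ1' 0%N (leq0n _))).
have := is_chain_cons (d := d.+1) (Q := fun i y => Q' i (f y)) _ pP PQ nQP.
move=> h; eexists; apply: h; split=> i id.
  by apply: preimage_prime; apply: cQ1'.
have [h1 h2] := cQ2' i id; split=> [y|h]; first exact: h1.
by apply: h2 => y; have [z <-] := fsurj y; apply: h.
Qed.

(** * Presentations of a ring with nilpotent maximal ideal and of its completion *)

Lemma rmorphism_factor (A B C : comNzRingType)
    (f : {rmorphism A -> B}) (g : {rmorphism A -> C}) :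
  (forall y, exists x, f x = y) -> (forall x, f x = 0 -> g x = 0) ->
  exists h : {rmorphism B -> C}, forall x, h (f x) = g x.
Proof.
move=> fsurj fg; have [s sK] := choice fsurj.
pose h y := g (s y).
have hf x : h (f x) = g x.
  by apply/eqP; rewrite -subr_eq0 /h -rmorphB fg // rmorphB sK subrr.
have hB : zmod_morphism h.
  by move=> x y; rewrite -(sK x) -(sK y) -rmorphB !hf rmorphB.
have hM : monoid_morphism h.
  split; first by rewrite -(rmorph1 f) hf rmorph1.
  by move=> x y; rewrite -(sK x) -(sK y) -rmorphM !hf rmorphM.
pose h1 := GRing.isZmodMorphism.Build _ _ h hB.
pose h2 := GRing.isMonoidMorphism.Build _ _ h hM.
by exists (HB.pack h h1 h2 : {rmorphism B -> C}).
Qed.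

Lemma ring_iso_of_kernels (A B C : comNzRingType)
    (f : {rmorphism A -> B}) (g : {rmorphism A -> C}) :
  (forall y, exists x, f x = y) -> (forall y, exists x, g x = y) ->
  (forall x, f x = 0 <-> g x = 0) -> ring_iso B C.
Proof.
move=> fsurj gsurj fg.
have [h hf] := rmorphism_factor fsurj (fun x => (fg x).1).
have [k kg] := rmorphism_factor gsurj (fun x => (fg x).2).
exists h; exists k => y.
  by have [x <-] := fsurj y; rewrite hf kg.
by have [x <-] := gsurj y; rewrite kg hf.
Qed.

Section QuotientRing.
Variables (A : comNzRingType) (I : idealr A).

Lemma quot_pi_eq0 x : \pi_({ideal_quot I}) x = 0 <-> x \in I.
Proof.
rewrite -[x in X in _ <-> X]subr0 Quotient.idealrBE -(rmorph0 \pi_({ideal_quot I})).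
by split=> [->|/eqP].
Qed.

Lemma quot_pi_surj (y : {ideal_quot I}) : exists x, \pi_({ideal_quot I}) x = y.
Proof. by exists (repr y); rewrite reprK. Qed.

End QuotientRing.

Section CompletionOfNilpotent.
Variables (R : comNzRingType) (m : idealr R).

Definition to_completion_fun (r : R) : adic_prod m := fun n => \pi_(adic_quot m n) r.

Lemma to_completion_coherent r : adic_coherent (to_completion_fun r).
Proof. by apply/asboolP => n; apply: adic_trans_pi. Qed.

Definition to_completion r : completion m := Completion (to_completion_coherent r).

Lemma to_completion_zmod : zmod_morphism to_completion.
Proof.
move=> x y; apply: val_inj; rewrite rmorphB /=.
by apply: functional_extensionality_dep => n; apply: (rmorphB \pi_(adic_quot m n)).
Qed.

Lemma to_completion_monoid : monoid_morphism to_completion.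
Proof.
split=> [|x y]; apply: val_inj; rewrite ?rmorph1 ?rmorphM /=;
  apply: functional_extensionality_dep => n.
  exact: (rmorph1 \pi_(adic_quot m n)).
exact: (rmorphM \pi_(adic_quot m n)).
Qed.

HB.instance Definition _ :=
  GRing.isZmodMorphism.Build R (completion m) to_completion to_completion_zmod.
HB.instance Definition _ :=
  GRing.isMonoidMorphism.Build R (completion m) to_completion to_completion_monoid.

Lemma to_completion_bij N : (forall x, x \in ideal_exp m N -> x = 0) ->
  (forall y, exists x, to_completion x = y) /\
  (forall x, to_completion x = 0 -> x = 0).
Proof.
move=> mN; split; last first.
  move=> x /(congr1 val)/(congr1 (fun c => c N)) h; apply: mN.
  by apply/quot_pi_eq0; exact: h.
move=> [c cP]; have /asboolP cc := cP.
have mNk k x : x \in ideal_exp m (N + k) -> x = 0.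
  elim: k x => [|k IH] x; first by rewrite addn0; apply: mN.
  rewrite addnS => /asboolP[s [sI ->]]; rewrite big_seq big1 // => p /sI[_ pJ].
  by rewrite (IH _ pJ) mulr0.
have down n x : c n.+1 = \pi_(adic_quot m n.+1) x -> c n = \pi_(adic_quot m n) x.
  by rewrite -(cc n) => ->; apply: adic_trans_pi.
have downk n k x : c (n + k)%N = \pi_(adic_quot m (n + k)) x -> c n = \pi_(adic_quot m n) x.
  by elim: k => [|k IH]; rewrite ?addn0 // addnS => /down/IH.
have [r er] := quot_pi_surj (c N).
exists r; apply: val_inj; apply: functional_extensionality_dep => n /=.
(* The index [n + N] dominates both n and N, so a lift s of that entry also lifts the entries at n
   and at N. The lift at N is unique, whence s = r. *)
have [s es] := quot_pi_surj (c (n + N)%N).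
have := downk _ _ _ (esym es).
move: es; rewrite addnC => es; have := downk _ _ _ (esym es).
rewrite -er => e; have -> // : s = r.
apply/eqP; rewrite -subr_eq0; apply/eqP/mN/quot_pi_eq0.
by rewrite rmorphB; apply/eqP; rewrite subr_eq0; apply/eqP/esym/e.
Qed.

Lemma presentation_of_completion N (S : comNzRingType) (I : idealr S) s :
  (forall x, x \in ideal_exp m N -> x = 0) -> ideal_spanned I s ->
  ring_iso (completion m) {ideal_quot I} ->
  exists f : {rmorphism S -> R}, (forall y, exists x, f x = y) /\
    forall x, f x = 0 <-> add_span (@zero_ideal S) s x.
Proof.
move=> mN Is [g [g' gK g'K]]; have [csurj cinj] := to_completion_bij mN.
pose j : {rmorphism R -> {ideal_quot I}} := g \o to_completion.
have g0 z : g z = 0 -> z = 0 by rewrite -{2}(gK z) => ->; rewrite -(rmorph0 g) gK.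
have jsurj y : exists x, j x = y.
  by have [x hx] := csurj (g' y); exists x; rewrite /= hx g'K.
have [|h hj] := rmorphism_factor (f := j) (g := idfun) jsurj.
  by move=> x /g0/cinj.
exists (h \o \pi_({ideal_quot I})); split.
  by move=> r; have [x hx] := quot_pi_surj (j r); exists x; rewrite /= hx; apply: hj.
move=> x; rewrite -in_spanE -Is -quot_pi_eq0 /=; split=> [|->]; last exact: rmorph0.
by have [r <-] := jsurj (\pi_({ideal_quot I}) x); rewrite hj /= => ->; exact: (rmorph0 j).
Qed.

Lemma completion_of_presentation N (S : comNzRingType) s (f : {rmorphism S -> R}) :
  (forall x, x \in ideal_exp m N -> x = 0) ->
  (forall y, exists x, f x = y) ->
  (forall x, f x = 0 <-> add_span (@zero_ideal S) s x) ->
  exists I : idealr S, ideal_spanned I s /\ ring_iso (completion m) {ideal_quot I}.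
Proof.
move=> mN fsurj kerf; have [csurj cinj] := to_completion_bij mN.
have [||I hI] := @idealr_of S (add_span (@zero_ideal S) s).
- exact/add_span_ideal/zero_is_ideal.
- by move/kerf/eqP; rewrite rmorph1 oner_eq0.
exists I; split; first by move=> x; rewrite hI in_spanE.
pose F : {rmorphism S -> completion m} := to_completion \o f.
pose G : {rmorphism S -> {ideal_quot I}} := \pi_({ideal_quot I}).
apply: (ring_iso_of_kernels (f := F) (g := G)).
- by move=> y; have [x <-] := csurj y; have [z <-] := fsurj x; exists z.
- exact: quot_pi_surj.
move=> x /=; rewrite quot_pi_eq0 hI -kerf; split=> [/cinj//|->]; exact: rmorph0.
Qed.

End CompletionOfNilpotent.

(** * Modules *)

Section ModuleTools.
Variable R : comNzRingType.
Implicit Types M N V : lmodType R.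

Definition is_submod V (N : V -> Prop) : Prop :=
  [/\ N 0, forall x y, N x -> N y -> N (x + y) & forall a x, N x -> N (a *: x)].

Lemma is_submodB V (N : V -> Prop) x y : is_submod N -> N x -> N y -> N (x - y).
Proof.
by case=> _ D Z Nx Ny; apply: D => //; rewrite -scaleN1r; apply: Z.
Qed.

Lemma in_span_submod V (s : seq V) : is_submod (in_span s).
Proof.
elim: s => [|a s [h0 hD hZ]].
  split; [exact/in_span_nil| |].
    by move=> x y /in_span_nil-> /in_span_nil->; apply/in_span_nil; rewrite addr0.
  by move=> b x /in_span_nil->; apply/in_span_nil; rewrite scaler0.
split.
- by apply/in_span_cons; exists 0; rewrite scale0r subr0.
- move=> x y /in_span_cons[r hr] /in_span_cons[t ht]; apply/in_span_cons.
  by exists (r + t); rewrite scalerDl opprD addrACA; apply: hD.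
- move=> b x /in_span_cons[r hr]; apply/in_span_cons; exists (b * r).
  by rewrite -scalerA -scalerBr; apply: hZ.
Qed.

Lemma in_span_mem V (s : seq V) x : x \in s -> in_span s x.
Proof.
elim: s => //= a s IH; rewrite inE => /orP[/eqP->|/IH h]; apply/in_span_cons.
  by exists 1; rewrite scale1r subrr; case: (in_span_submod s).
by exists 0; rewrite scale0r subr0.
Qed.

Lemma in_span_sub V (s : seq V) (N : V -> Prop) x : is_submod N ->
  (forall a, a \in s -> N a) -> in_span s x -> N x.
Proof.
move=> sN; have [N0 ND NZ] := sN; elim: s x => [|a s IH] x sub.
  by move/in_span_nil->.
move/in_span_cons=> [r /IH h]; rewrite -(subrK (r *: a) x); apply: ND.
  by apply: h => b bs; apply: sub; rewrite inE bs orbT.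
by apply: NZ; apply: sub; rewrite mem_head.
Qed.

Lemma linear_of M N (f : M -> N) : linear f -> exists g : {linear M -> N}, g =1 f.
Proof.
move=> lf; pose l := GRing.isLinear.Build R M N _ f lf.
by exists (HB.pack f l : {linear M -> N}).
Qed.

Lemma linear_factor V M N (f : {linear V -> M}) (g : {linear V -> N}) :
  (forall y, exists x, f x = y) -> (forall x, f x = 0 -> g x = 0) ->
  exists h : {linear M -> N}, forall x, h (f x) = g x.
Proof.
move=> fsurj fg; have [s sK] := choice fsurj.
have hf x : g (s (f x)) = g x.
  by apply/eqP; rewrite -subr_eq0 -linearB fg // linearB /= sK subrr.
have [|h hE] := @linear_of M N (fun y => g (s y)).
  by move=> a x y; rewrite -{1}(sK x) -{1}(sK y) -linearP hf linearP.
by exists h => x; rewrite hE.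
Qed.

Lemma mod_iso_of_kernels V M N (f : {linear V -> M}) (g : {linear V -> N}) :
  (forall y, exists x, f x = y) -> (forall y, exists x, g x = y) ->
  (forall x, f x = 0 <-> g x = 0) -> mod_iso M N.
Proof.
move=> fsurj gsurj fg.
have [h hf] := linear_factor fsurj (fun x => (fg x).1).
have [k kg] := linear_factor gsurj (fun x => (fg x).2).
exists h; exists k => y.
  by have [x <-] := fsurj y; rewrite hf kg.
by have [x <-] := gsurj y; rewrite kg hf.
Qed.

Lemma mod_iso_of M N (f : {linear M -> N}) :
  (forall x, f x = 0 -> x = 0) -> (forall y, exists x, f x = y) -> mod_iso M N.
Proof.
move=> finj fsurj; apply: (@mod_iso_of_kernels M M N idfun f) => //.
  by move=> y; exists y.
by move=> x; split=> [/= ->|/finj//]; rewrite linear0.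
Qed.

Lemma mod_iso_inv M N (f : {linear M -> N}) : bijective f ->
  exists g : {linear N -> M}, cancel f g /\ cancel g f.
Proof.
move=> [g fK gK]; have [|h hE] := @linear_of N M g.
  move=> a x y; apply: (can_inj fK).
  by rewrite gK linearP !gK.
by exists h; split=> x; rewrite hE.
Qed.

Lemma mod_iso_sym M N : mod_iso M N -> mod_iso N M.
Proof. by move=> [f /mod_iso_inv[g [fK gK]]]; exists g; exists f. Qed.

Lemma mod_iso_trans M N V : mod_iso M N -> mod_iso N V -> mod_iso M V.
Proof. by move=> [f bf] [g bg]; exists (g \o f); apply: bij_comp. Qed.

Lemma in_span_linear M N (f : {linear M -> N}) s x :
  in_span s x -> in_span (map f s) (f x).
Proof.
have [h0 hD hZ] := in_span_submod (map f s).
apply: (in_span_sub (N := fun x => in_span (map f s) (f x))).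
  split; rewrite ?linear0 //.
    by move=> u v; rewrite linearD; apply: hD.
  by move=> a u; rewrite linearZ; apply: hZ.
by move=> a ains; apply/in_span_mem/map_f.
Qed.

Lemma fin_gen_image M N (f : {linear M -> N}) :
  (forall y, exists x, f x = y) -> fin_gen M -> fin_gen N.
Proof.
move=> fsurj [s hs]; exists (map f s) => y.
by have [x <-] := fsurj y; apply: in_span_linear.
Qed.

Lemma fin_gen_regular : fin_gen (R^o : lmodType R).
Proof.
exists [:: 1] => y; apply/in_span_cons; exists y.
by apply/in_span_nil; rewrite /GRing.scale /= mulr1 subrr.
Qed.

Lemma exists_inl M N : exists f : {linear M -> (M * N)%type}, forall x, f x = (x, 0).
Proof.
apply: (@linear_of M (M * N)%type (fun x => (x, 0))) => a x y.
by congr pair; rewrite /= scaler0 addr0.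
Qed.

Lemma mod_iso_fin_gen M N : mod_iso M N -> fin_gen M -> fin_gen N.
Proof.
by move=> [f [g _ gK]]; apply: (fin_gen_image (f := f)) => y; exists (g y).
Qed.

Lemma row_delta n (v : 'rV[R]_n) : v = \sum_i v 0 i *: delta_mx 0 i.
Proof. by rewrite {1}(row_sum_delta v). Qed.

Lemma fin_gen_row n : fin_gen 'rV[R]_n.
Proof.
exists [seq delta_mx 0 i | i : 'I_n] => v; rewrite (row_delta v).
have [h0 hD hZ] := in_span_submod [seq (delta_mx 0 i : 'rV[R]_n) | i : 'I_n].
elim/big_ind: _ => // i _; apply: hZ; apply: in_span_mem.
by apply/mapP; exists i => //; rewrite mem_enum.
Qed.

Lemma zero_module_free M : zero_module M -> fin_free M.
Proof.
move=> M0; exists 0%N; apply: mod_iso_sym.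
have [f _] := @linear_of M 'rV[R]_0 (fun=> 0) (fun a x y => esym (etrans (addr0 _) (scaler0 _ a))).
apply: (mod_iso_of (f := f)) => [x _|y]; first exact: M0.
by exists 0; apply/rowP => -[].
Qed.

Lemma exists_quotient_module V (N : V -> Prop) : is_submod N ->
  exists (Q : lmodType R) (p : {linear V -> Q}),
    (forall y, exists x, p x = y) /\ forall x, p x = 0 <-> N x.
Proof.
move=> sN; have [N0 ND NZ] := sN.
pose I0 : {pred V} := fun x => `[< N x >].
have cl : zmod_closed I0.
  split; first exact: asboolT.
  by move=> x y /asboolW Nx /asboolW Ny; apply: asboolT; apply: is_submodB.
pose cI := GRing.isZmodClosed.Build V I0 cl.
pose I : zmodClosed V := HB.pack I0 cI.
pose Q := @Quotient.quot V I.
have piE x y : (\pi_Q x = \pi_Q y) <-> N (x - y).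
  split=> [/eqP|h].
    by rewrite -Quotient.idealrBE => /asboolW.
  by apply/eqP; rewrite -Quotient.idealrBE; apply: asboolT.
pose sc a (x : Q) : Q := \pi_Q (a *: repr x).
have scE a x : sc a (\pi_Q x) = \pi_Q (a *: x).
  by apply: (piE _ _).2; rewrite -scalerBr; apply: NZ; apply: (piE _ _).1; apply: reprK.
have rp (x : Q) : exists y, x = \pi_Q y by exists (repr x); rewrite reprK.
have sA a b x : sc a (sc b x) = sc (a * b) x.
  by have [y ->] := rp x; rewrite !scE scalerA.
have s1 : left_id 1 sc by move=> x; have [y ->] := rp x; rewrite scE scale1r.
have sDr : right_distributive sc +%R.
  move=> a x y; have [x' ->] := rp x; have [y' ->] := rp y.
  by rewrite -raddfD !scE scalerDr raddfD.
have sDl x : {morph sc^~ x : a b / a + b}.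
  by move=> a b; have [x' ->] := rp x; rewrite !scE scalerDl raddfD.
pose lQ := GRing.Zmodule_isLmodule.Build R Q sA s1 sDr sDl.
pose Q' : lmodType R := HB.pack Q lQ.
have [|p pE] := @linear_of V Q' (fun x => \pi_Q x).
  by move=> a x y; rewrite raddfD /= -scE.
exists Q', p; split=> [y|x]; first by exists (repr (y : Q)); rewrite pE; apply: reprK.
have := piE x 0; rewrite subr0 raddf0 pE; exact.
Qed.

Lemma exists_submodule V (N : V -> Prop) : is_submod N ->
  exists (S : lmodType R) (i : {linear S -> V}),
    (forall x, i x = 0 -> x = 0) /\ forall v, N v <-> exists x, i x = v.
Proof.
move=> [N0 ND NZ].
pose I0 : {pred V} := fun x => `[< N x >].
have cl : submod_closed I0.
  split; first exact: asboolT.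
  move=> a x y /asboolW Nx /asboolW Ny; apply: asboolT.
  by apply: ND => //; apply: NZ.
pose S : Type := {x : V | I0 x}.
pose lS := @GRing.SubChoice_isSubLmodule.Build R V I0 {x : V | I0 x} (GRing.submod_closed_semi cl).
pose S' : lmodType R := HB.pack {x : V | I0 x} lS.
have [|i iE] := @linear_of S' V (fun x => sval x); first by [].
exists S', i; split=> [x|v].
  by rewrite iE => x0; apply: val_inj.
split=> [Nv|[x <-]]; last by rewrite iE; apply: asboolW (svalP x).
by exists (exist _ v (asboolT Nv)); rewrite iE.
Qed.
End ModuleTools.

(** * Extension-closed subcategories from matrix factorisations *)

Section HomologyClass.
Variable R : comNzRingType.
Implicit Types L M N V W : lmodType R.

Definition mat_act V p q (A : 'M[R]_(p, q)) (u : 'I_q -> V) : 'I_p -> V :=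
  fun i => \sum_j A i j *: u j.

Lemma mat_actM V p q r (A : 'M[R]_(p, q)) (B : 'M[R]_(q, r)) (u : 'I_r -> V) i :
  mat_act A (mat_act B u) i = mat_act (A *m B) u i.
Proof.
rewrite /mat_act; under eq_bigr => j _ do rewrite scaler_sumr.
rewrite exchange_big /=; apply: eq_bigr => k _; rewrite mxE scaler_suml.
by apply: eq_bigr => j _; rewrite scalerA.
Qed.

Lemma mat_act_linear V W p q (A : 'M[R]_(p, q)) (f : {linear V -> W}) u i :
  f (mat_act A u i) = mat_act A (fun j => f (u j)) i.
Proof. by rewrite /mat_act linear_sum; apply: eq_bigr => j _; rewrite linearZ. Qed.

Lemma mat_actB V p q (A : 'M[R]_(p, q)) (u v : 'I_q -> V) i :
  mat_act A (fun j => u j - v j) i = mat_act A u i - mat_act A v i.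
Proof. by rewrite /mat_act -sumrB; apply: eq_bigr => j _; rewrite scalerBr. Qed.

Lemma mat_actD V p q (A : 'M[R]_(p, q)) (u v : 'I_q -> V) i :
  mat_act A (fun j => u j + v j) i = mat_act A u i + mat_act A v i.
Proof. by rewrite /mat_act -big_split; apply: eq_bigr => j _; rewrite scalerDr. Qed.

(** Vanishing of the homology of V^n -B-> V^n -A-> V^n at the middle, the stand-in for Tor_1(coker
    A, V) = 0. *)
Definition exact_on n (A B : 'M[R]_n) V : Prop :=
  forall u : 'I_n -> V, (forall i, mat_act A u i = 0) ->
    exists w, forall i, u i = mat_act B w i.

Lemma exact_on_iso n (A B : 'M[R]_n) M N :
  mod_iso M N -> exact_on A B M -> exact_on A B N.
Proof.
move=> [f /mod_iso_inv[g [fK gK]]] ex u Au.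
have [|w hw] := ex (fun i => g (u i)).
  by move=> i; rewrite -mat_act_linear Au linear0.
exists (fun i => f (w i)) => i; rewrite -mat_act_linear.
by apply: (can_inj gK); rewrite hw fK.
Qed.

(** The middle part of a long exact homology sequence, chased by elements. A cycle of M bounds in N;
    subtracting a lift of that boundary leaves a cycle of L, because A B = 0. *)
Lemma extension_closed_exact_on n (A B : 'M[R]_n) : A *m B = 0 ->
  extension_closed (fun M => fin_gen M /\ exact_on A B M).
Proof.
move=> AB0.
have act0 V (w : 'I_n -> V) i : mat_act A (mat_act B w) i = 0.
  by rewrite mat_actM AB0 /mat_act big1 // => j _; rewrite mxE scale0r.
split.
- split.
  + exists 'rV[R]_0; split; first exact: fin_gen_row.
    by move=> u _; exists (fun=> 0) => i; apply/rowP => -[].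
  + by move=> M [].
  + move=> M N MN [fM exM]; split; first exact: mod_iso_fin_gen MN fM.
    exact: exact_on_iso MN exM.
- move=> M N [fMN ex]; split.
    by apply: (fin_gen_image (f := fst)) fMN => x; exists (x, 0).
  have [i1 i1E] := exists_inl M N.
  move=> u Au; have [|w hw] := ex (fun i => i1 (u i)).
    by move=> i; rewrite -mat_act_linear Au linear0.
  exists (fun i => fst (w i)) => i.
  by rewrite -(mat_act_linear B fst w i) -hw i1E.
- move=> L M N f g fM [finj fg gsurj] [fL exL] [fN exN]; split=> // u Au.
  have [|w hw] := exN (fun i => g (u i)).
    by move=> i; rewrite -mat_act_linear Au linear0.
  have [w' hw'] := choice (fun i => gsurj (w i)).
  have /choice[v hv] i : exists x, f x = u i - mat_act B w' i.
    apply/fg; rewrite linearB /= mat_act_linear hw; apply/eqP; rewrite subr_eq0.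
    by apply/eqP/eq_bigr => j _; rewrite hw'.
  have [|z hz] := exL v.
    move=> i; apply: finj; rewrite linear0 mat_act_linear.
    transitivity (mat_act A (fun i => u i - mat_act B w' i) i).
      by apply: eq_bigr => j _; rewrite hv.
    by rewrite mat_actB Au act0 subr0.
  exists (fun j => w' j + f (z j)) => i.
  by rewrite mat_actD -mat_act_linear -hz hv addrC subrK.
Qed.

(** On R/m both matrices act as zero, so the homology is all of (R/m)^n, which is nonzero as n >
    0. *)
Lemma not_exact_on_residue_field (m : idealr R) n (A B : 'M[R]_n) :
  (0 < n)%N -> (forall i j, A i j \in m) -> (forall i j, B i j \in m) ->
  exists M, fin_gen M /\ ~ exact_on A B M.
Proof.
move=> n_gt0 Am Bm.
have sm : is_submod (V := R^o) (fun x => x \in m) by exact: (idealr_is_ideal m).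
have [Q [p [psurj kerp]]] := exists_quotient_module sm.
have act0 (C : 'M[R]_n) (u : 'I_n -> Q) i : (forall i j, C i j \in m) -> mat_act C u i = 0.
  move=> Cm; apply: big1 => j _; have [x <-] := psurj (u j).
  by rewrite -linearZ; apply/kerp; rewrite /= /GRing.scale /= mulrC; apply: idealMr.
exists Q; split.
  exact: fin_gen_image psurj (fin_gen_regular R).
move=> /(_ (fun=> p 1))[i|w /(_ (Ordinal n_gt0))]; first exact: act0.
by rewrite act0 // => /kerp; rewrite idealr1.
Qed.

Lemma cokernel_module p q (C : 'M[R]_(q, p)) :
  exists (Q : lmodType R) (f : {linear 'rV[R]_p -> Q}),
    (forall y, exists x, f x = y) /\ forall x, f x = 0 <-> exists w, x = w *m C.
Proof.
apply: exists_quotient_module; split; first by exists 0; rewrite mul0mx.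
  by move=> _ _ [v ->] [w ->]; exists (v + w); rewrite mulmxDl.
by move=> a _ [v ->]; exists (a *: v); rewrite scalemxAl.
Qed.

(* A free quotient splits, giving C = C Z C; the minor 1 - Z C is invertible. *)
Lemma cokernel_not_free (m : idealr R) p q (C : 'M[R]_(q, p)) (Q : lmodType R)
    (f : {linear 'rV[R]_p -> Q}) :
  is_local_max (fun x => x \in m) -> (forall i j, C i j \in m) ->
  (forall y, exists x, f x = y) -> (forall x, f x = 0 <-> exists w, x = w *m C) ->
  fin_free Q -> C = 0.
Proof.
move=> [_ _ um] Cm fsurj kerf [r [h /mod_iso_inv[h' [hK h'K]]]].
have /choice[l hl] i : exists x, f x = h (delta_mx 0 i) by apply: fsurj.
pose L := \matrix_(i < r) l i.
have fL (v : 'rV_r) : f (v *m L) = h v.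
  rewrite mulmx_sum_row linear_sum {2}(row_delta v) linear_sum.
  by apply: eq_bigr => i _; rewrite rowK !linearZ /= hl.
(* [t v] is a lift of f v through the free module, linear in v. Hence v - t v lies in the row space
   of C, and [Z] records the coefficients for all v at once. *)
pose t (v : 'rV_p) := h' (f v) *m L.
have ft v : f (t v) = f v by rewrite fL h'K.
have /choice[z hz] i : exists w, delta_mx 0 i - t (delta_mx 0 i) = w *m C.
  by apply/kerf; rewrite linearB /= ft subrr.
pose Z := \matrix_(i < p) z i.
have tE v : v - t v = v *m Z *m C.
  transitivity (\sum_i v 0 i *: (delta_mx 0 i - t (delta_mx 0 i))).
    under eq_bigr => i _ do rewrite scalerBr.
    rewrite sumrB -row_delta; congr (_ - _).
    rewrite /t {1}(row_delta v) !linear_sum mulmx_suml.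
    by apply: eq_bigr => i _; rewrite !linearZ /= -scalemxAl.
  rewrite [v *m Z]mulmx_sum_row mulmx_suml; apply: eq_bigr => i _.
  by rewrite hz rowK scalemxAl.
have CZC : C = C *m Z *m C.
  apply/row_matrixP => i; rewrite -mulmxA row_mul mulmxA -tE /t.
  have -> : f (row i C) = 0 by apply/kerf; exists (delta_mx 0 i); rewrite -rowE.
  by rewrite linear0 mul0mx subr0.
pose D := 1%:M - Z *m C.
(* Z C vanishes modulo m, so the determinant of D is 1 modulo m and therefore a unit. *)
have [|y hy] := um (\det D).
  move=> hD.
  have : \pi_({ideal_quot m}) (\det D) = 1.
    rewrite -det_map_mx; have -> : map_mx \pi_({ideal_quot m}) D = 1%:M.
      rewrite /D raddfB /= map_scalar_mx rmorph1 map_mxM.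
      have -> : map_mx \pi_({ideal_quot m}) C = 0.
        by apply/matrixP => i j; rewrite !mxE; apply/quot_pi_eq0.
      by rewrite mulmx0 subr0.
    by rewrite det1.
  by move/quot_pi_eq0: hD => -> /eqP; rewrite eq_sym oner_eq0.
have CD : C *m D = 0 by rewrite mulmxBr mulmx1 mulmxA -CZC subrr.
rewrite -(mulmx1 C) -[1%:M](_ : y *: (D *m \adj D) = _); last first.
  by rewrite mul_mx_adj scale_scalar_mx hy.
by rewrite -scalemxAr mulmxA CD mul0mx scaler0.
Qed.

End HomologyClass.

Section MatrixFactorisation.
Variable S : comNzRingType.
Implicit Types (W : S -> Prop).

Lemma prod_add_sum W x : prod_add W W (@zero_ideal S) x ->
  is_ideal W -> exists s : seq (S * S),
    (forall p, p \in s -> W p.1 /\ W p.2) /\ x = \sum_(p <- s) p.1 * p.2.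
Proof.
move=> hx iW; pose J y := exists s : seq (S * S),
  (forall p, p \in s -> W p.1 /\ W p.2) /\ y = \sum_(p <- s) p.1 * p.2.
apply: (hx J).
- split; first by exists [::]; rewrite big_nil.
    move=> _ _ [s [hs ->]] [t [ht ->]]; exists (s ++ t); rewrite big_cat; split=> // p.
    by rewrite mem_cat => /orP[/hs|/ht].
  move=> a _ [s [hs ->]]; exists [seq (a * p.1, p.2) | p <- s]; split.
    by move=> p /mapP[q /hs[h1 h2] ->]; split=> //; exact: (is_idealMl a iW h1).
  by rewrite big_map mulr_sumr; apply: eq_bigr => p _; rewrite mulrA.
- by move=> _ ->; exists [::]; rewrite big_nil.
- move=> a b Wa Wb; exists [:: (a, b)]; rewrite big_seq1; split=> // p.
  by rewrite inE => /eqP->.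
Qed.

(* The Koszul-type factorisation of f = a_1 b_1 + ... + a_k b_k. *)
Lemma matrix_factorisation W x : is_ideal W -> prod_add W W (@zero_ideal S) x ->
  exists n (A B : 'M[S]_n), [/\ (0 < n)%N, A *m B = x%:M, B *m A = x%:M,
    forall i j, W (A i j) & forall i j, W (B i j)].
Proof.
move=> iW /prod_add_sum[//|s [hs ->]]; have W0 := is_ideal0 iW.
elim: s hs => [|[a b] s IH] hs.
  (* The zero element is factored in size 1, not 0, to keep n positive. *)
  exists 1%N, 0, 0; rewrite big_nil mul0mx raddf0.
  by split=> // i j; rewrite mxE.
have [|n [A [B [n0 AB BA WA WB]]]] := IH.
  by move=> p ps; apply: hs; rewrite inE ps orbT.
have [/= Wa Wb] := hs (a, b) (mem_head _ _).
have Wsc c i j : W c -> W ((c%:M : 'M_n) i j) by move=> Wc; rewrite mxE; case: eqP.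
have comm (c : S) (C : 'M_n) : c%:M *m C = C *m c%:M by rewrite scalar_mxC.
exists (n + n)%N, (block_mx A (- b%:M) a%:M B), (block_mx B b%:M (- a%:M) A).
have Wbl (C1 C2 C3 C4 : 'M[S]_n) : (forall i j, W (C1 i j)) -> (forall i j, W (C2 i j)) ->
    (forall i j, W (C3 i j)) -> (forall i j, W (C4 i j)) ->
    forall i j, W (block_mx C1 C2 C3 C4 i j).
  move=> h1 h2 h3 h4 i j; rewrite -[i]splitK -[j]splitK.
  by case: (split i) => i'; case: (split j) => j' /=;
    rewrite ?block_mxEul ?block_mxEur ?block_mxEdl ?block_mxEdr.
split.
- by rewrite addn_gt0 n0.
- rewrite mulmx_block big_cons scalar_mx_block /= AB BA raddfD /= scalar_mxM.
  rewrite !mulNmx !mulmxN opprK (comm b A) (comm a B) (comm b a%:M) subrr addrN.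
  by congr block_mx; rewrite addrC.
- rewrite mulmx_block big_cons scalar_mx_block /= AB BA raddfD /= scalar_mxM.
  rewrite !mulNmx !mulmxN opprK (comm b B) (comm a A) (comm b a%:M) addNr addNr.
  by congr block_mx; rewrite addrC.
- by apply: Wbl => // i j; [rewrite mxE; apply: is_idealN => //|]; apply: Wsc.
- by apply: Wbl => // i j; [|rewrite mxE; apply: is_idealN => //]; apply: Wsc.
Qed.

End MatrixFactorisation.

Section TwoRelations.
Variables (S R : comNzRingType) (m : idealr R) (f : {rmorphism S -> R}).
Hypothesis maxm : is_local_max (fun x => x \in m).
Hypothesis fsurj : forall y, exists x, f x = y.

Let W : S -> Prop := fun x => f x \in m.

Lemma map_mx_surj p q (M : 'M[R]_(p, q)) : exists N : 'M[S]_(p, q), map_mx f N = M.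
Proof.
have [g gK] := choice fsurj; exists (map_mx g M).
by apply/matrixP => i j; rewrite !mxE.
Qed.

(* Let AB = a and CD = b be matrix factorisations with entries in the maximal
   ideal.  Tor_1 of the cokernels of A and C over S/(a,b) vanishes, so
   the modules M with H(M^n -B-> M^n -A-> M^n) = 0 form an extension-closed
   subcategory containing coker C, which is not free, but not R/m. *)
Lemma nontrivial_extension_closed_of_two_relations a b :
  regular_on (@zero_ideal S) [:: a; b] ->
  (forall x, f x = 0 <-> add_span (@zero_ideal S) [:: a; b] x) ->
  prod_add W W (@zero_ideal S) a -> prod_add W W (@zero_ideal S) b ->
  ~ only_trivial_extension_closed R.
Proof.
move=> [rega [regb _]] kerf Wa Wb triv.
have iW : is_ideal W := preimage_ideal f (idealr_is_ideal m).
have [n [A [B [n_gt0 AB BA WA WB]]]] := matrix_factorisation iW Wa.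
have [p [C [D [p_gt0 CD DC WC WD]]]] := matrix_factorisation iW Wb.
have kerE x : f x = 0 <-> exists r s, x = r * a + s * b.
  rewrite kerf /add_span /=; split=> [[r [_ [s [_ e]]]]|[r [s ->]]].
    by exists r, s; apply/eqP; rewrite -subr_eq0 opprD addrA; apply/eqP.
  by exists r; split=> //; exists s; split=> //; rewrite /zero_ideal; ring.
have fa : f a = 0 by apply/kerE; exists 1, 0; ring.
have fb : f b = 0 by apply/kerE; exists 0, 1; ring.
have rega0 x : a * x = 0 -> x = 0 := rega x.
have regb0 x y : b * x = a * y -> exists z, x = a * z.
  move=> e; have [|z [_ ez]] := regb x.
    by exists y; split=> //; rewrite /zero_ideal e; ring.
  by exists z; apply/eqP; rewrite mulrC -subr_eq0; apply/eqP.
pose mA := map_mx f A; pose mB := map_mx f B; pose mC := map_mx f C.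
have mAB : mA *m mB = 0 by rewrite -map_mxM AB map_scalar_mx fa raddf0.
have [Q [g [gsurj kerg]]] := cokernel_module mC.
have finQ : fin_gen Q by apply: (fin_gen_image gsurj); apply: fin_gen_row.
have exQ : exact_on mA mB Q.
  move=> u Au.
  have /choice[l hl] i : exists v : 'rV[S]_p, g (map_mx f v) = u i.
    by have [v <-] := gsurj (u i); have [v' <-] := map_mx_surj v; exists v'.
  pose U := \matrix_(i < n) l i.
  (* The rows of Y represent elements of Q, and multiplication on the left by X becomes
     [mat_act]. *)
  have act q (X : 'M[S]_(q, n)) (Y : 'M[S]_(n, p)) (w : 'I_n -> Q) :
      (forall j, g (map_mx f (row j Y)) = w j) ->
      forall i, g (map_mx f (row i (X *m Y))) = mat_act (map_mx f X) w i.
    move=> hw i; rewrite row_mul map_mxM mulmx_sum_row linear_sum.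
    by apply: eq_bigr => j _; rewrite linearZ /= -map_row hw !mxE.
  have hU j : g (map_mx f (row j U)) = u j by rewrite rowK hl.
  have /choice[v hv] i : exists w, map_mx f (row i (A *m U)) = w *m mC.
    by apply/kerg; rewrite (act _ _ _ u).
  have [V hV] := map_mx_surj (\matrix_(i < n) v i).
  have fAU : map_mx f (A *m U - V *m C) = 0.
    apply/row_matrixP => i; rewrite raddfB /= [map_mx f (V *m C)]map_mxM hV.
    by rewrite raddfB /= -map_row hv row_mul rowK subrr raddf0.
  have /choice[w1 hw1] (ij : 'I_n * 'I_p) : exists rs : S * S,
      (A *m U - V *m C) ij.1 ij.2 = rs.1 * a + rs.2 * b.
    have /kerE[r [s e]] : f ((A *m U - V *m C) ij.1 ij.2) = 0.
      by have := congr1 (fun M : 'M_(n, p) => M ij.1 ij.2) fAU; rewrite !mxE.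
    by exists (r, s).
  pose W1 := \matrix_(i < n, j < p) (w1 (i, j)).1.
  pose W2 := \matrix_(i < n, j < p) (w1 (i, j)).2.
  have AUE : A *m U - V *m C = a *: W1 + b *: W2.
    by apply/matrixP => i j; rewrite (hw1 (i, j)) !mxE mulrC [b * _]mulrC.
  (* Lifting the cycle gives A U = V C + a W1 + b W2. Since a = A B and b = D C, the two error terms
     are absorbed into U and V, which leaves A U' = V' C. *)
  pose U' := U - B *m W1; pose V' := V + W2 *m D.
  have AU' : A *m U' = V' *m C.
    rewrite mulmxBr mulmxDl mulmxA AB -mulmxA DC mul_scalar_mx mul_mx_scalar.
    have -> : A *m U = a *: W1 + b *: W2 + V *m C by rewrite -AUE subrK.
    by rewrite addrAC [a *: W1 + _]addrC addrK addrC.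
  have aU' : a *: U' = B *m V' *m C.
    by rewrite -mulmxA -AU' mulmxA BA mul_scalar_mx.
  (* Multiplying a U' = B V' C by D exhibits b B V' as a multiple of a. Regularity of b modulo a
     then gives B V' = a V2, and cancelling a gives U' = V2 C, which dies in Q. *)
  have bV' : a *: (U' *m D) = b *: (B *m V').
    by rewrite scalemxAl aU' -mulmxA CD mul_mx_scalar.
  have /choice[v2 hv2] (ij : 'I_n * 'I_p) : exists z, (B *m V') ij.1 ij.2 = a * z.
    apply: (regb0 _ ((U' *m D) ij.1 ij.2)).
    by have := congr1 (fun M : 'M_(n, p) => M ij.1 ij.2) bV'; rewrite !mxE.
  pose V2 := \matrix_(i < n, j < p) v2 (i, j).
  have BV' : B *m V' = a *: V2 by apply/matrixP => i j; rewrite (hv2 (i, j)) !mxE.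
  have U'E : U' = V2 *m C.
    apply/matrixP => i j; apply/eqP; rewrite -subr_eq0; apply/eqP/rega0.
    rewrite mulrBr; apply/eqP; rewrite subr_eq0; apply/eqP.
    have := congr1 (fun M : 'M_(n, p) => M i j) aU'.
    by rewrite BV' -scalemxAl !mxE.
  have UE : U = V2 *m C + B *m W1 by rewrite -U'E subrK.
  exists (fun j => g (map_mx f (row j W1))) => i.
  rewrite -(act _ _ W1) // -hU UE !raddfD /=.
  have -> : g (map_mx f (row i (V2 *m C))) = 0.
    by apply/kerg; exists (map_mx f (row i V2)); rewrite row_mul map_mxM.
  by rewrite add0r.
have mCm i j : mC i j \in m by rewrite mxE; apply: WC.
have nfree : ~ fin_free Q.
  move=> /(cokernel_not_free maxm mCm gsurj kerg) C0.
  have hC i j : exists rs : S * S, C i j = rs.1 * a + rs.2 * b.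
    have /kerE[r [s e]] : f (C i j) = 0.
      by have := congr1 (fun M : 'M_p => M i j) C0; rewrite !mxE.
    by exists (r, s).
  have /choice[c hc] j := hC (Ordinal p_gt0) j.
  (* If C vanishes over R, its entries lie in (a, b), and a diagonal entry of C D = b reads b (1 -
     e) = a (...) with e in the maximal ideal. Then a divides 1 - e, so e maps to 1 in R, which is
     absurd. *)
  pose i0 := Ordinal p_gt0; pose e := \sum_j (c j).2 * D j i0.
  have be : b * (1 - e) = a * \sum_j (c j).1 * D j i0.
    have eb : b = \sum_j C i0 j * D j i0.
      by have := congr1 (fun M : 'M_p => M i0 i0) CD; rewrite !mxE eqxx mulr1n => <-.
    rewrite mulrBr mulr1 {1}eb !mulr_sumr -sumrB; apply: eq_bigr => j _.
    by rewrite hc; ring.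
  have [z ez] := regb0 _ _ be.
  have : f (1 - e) = 0 by rewrite ez rmorphM fa mul0r.
  rewrite rmorphB rmorph1 => /eqP; rewrite subr_eq0 => /eqP e1.
  have : W e by apply: (big_ind W); [exact: is_ideal0|by move=> x y; apply: is_idealD|
    by move=> j _; apply: is_idealMl].
  by rewrite /W -e1 idealr1.
have [h|h|h] := triv _ (extension_closed_exact_on mAB).
- have /h/zero_module_free : fin_gen Q /\ exact_on mA mB Q by [].
  exact: nfree.
- by have /h : fin_gen Q /\ exact_on mA mB Q by [].
have [||M [fM nex]] := @not_exact_on_residue_field R m n mA mB n_gt0.
- by move=> i j; rewrite mxE; apply: WA.
- by move=> i j; rewrite mxE; apply: WB.
by have /h[] := fM.
Qed.
End TwoRelations.

(** * Elimination of relations from a regular presentation *)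

Lemma add_span_mapE (A B : comNzRingType) (f : {rmorphism A -> B})
    (J : A -> Prop) (J' : B -> Prop) s x :
  (forall y, exists x, f x = y) -> (forall y, J y <-> J' (f y)) ->
  add_span J s x <-> add_span J' (map f s) (f x).
Proof.
move=> fsurj JJ'; rewrite /add_span; elim: s x => [|a s IH] x /=; first exact: JJ'.
split=> -[r [_ h]].
  by exists (f r); split=> //; rewrite -rmorphM -rmorphB -IH.
have [q e] := fsurj r; exists q; split=> //.
by rewrite IH rmorphB rmorphM e.
Qed.

Lemma prod_add_map (A B : comNzRingType) (f : {rmorphism A -> B})
    (W : A -> Prop) (W' : B -> Prop) x : (forall y, W y -> W' (f y)) ->
  prod_add W W (@zero_ideal A) x -> prod_add W' W' (@zero_ideal B) (f x).
Proof.
move=> WW' h I iI I0 IM; apply: (h (fun x => I (f x))).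
- exact: preimage_ideal.
- by move=> y ->; apply: I0; apply: rmorph0.
- by move=> a b /WW' ha /WW' hb; rewrite rmorphM; apply: IM.
Qed.

Lemma regular_quotient_step (S R : comNzRingType) (f : {rmorphism S -> R}) a t :
  (forall y, exists x, f x = y) ->
  (forall x, f x = 0 <-> add_span (@zero_ideal S) (a :: t) x) ->
  regular_on (@zero_ideal S) (a :: t) ->
  exists (B : comNzRingType) (p : {rmorphism S -> B}) (h : {rmorphism B -> R}),
    [/\ forall y, exists x, p x = y, forall x, p x = 0 <-> principal a x,
      forall x, h (p x) = f x,
      forall x, h x = 0 <-> add_span (@zero_ideal B) (map p t) x &
      regular_on (@zero_ideal B) (map p t)].
Proof.
move=> fsurj kerf [_ regt].
have i0 := zero_is_ideal S.
have fa c : f (c * a) = 0.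
  by apply/kerf; apply: is_idealMl; [exact: add_span_ideal|apply: add_span_mem; rewrite ?mem_head].
have [||I hI] := @idealr_of S (principal a); first exact: principal_ideal.
  by move=> [c e]; have /eqP := fa c; rewrite -e rmorph1 oner_eq0.
pose p : {rmorphism S -> {ideal_quot I}} := \pi_({ideal_quot I}).
have psurj : forall y, exists x, p x = y by exact: quot_pi_surj.
have kerp x : p x = 0 <-> principal a x by rewrite -hI; apply: quot_pi_eq0.
have [|h hp] := rmorphism_factor (f := p) (g := f) psurj.
  by move=> x /kerp[c ->].
have pE x : add_span (@zero_ideal S) [:: a] x <-> zero_ideal (p x).
  rewrite /zero_ideal kerp; split=> [[c [_ e]]|[c ->]]; exists c.
    by apply/eqP; rewrite -subr_eq0; apply/eqP.
  by rewrite subrr.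
exists {ideal_quot I}, p, h; split=> //.
  move=> y; have [x <-] := psurj y.
  by rewrite hp kerf -add_span_cons //; apply: add_span_mapE.
exact: regular_on_map regt.
Qed.

(* Reduce to two relations by killing the first ones. *)
Lemma nontrivial_extension_closed_of_many_relations (R : comNzRingType)
    (m : idealr R) (S : comNzRingType) (f : {rmorphism S -> R}) s :
  is_local_max (fun x => x \in m) -> (forall y, exists x, f x = y) ->
  (1 < size s)%N -> regular_on (@zero_ideal S) s ->
  (forall x, f x = 0 <-> add_span (@zero_ideal S) s x) ->
  (forall a, a \in s ->
     prod_add (fun x => f x \in m) (fun x => f x \in m) (@zero_ideal S) a) ->
  ~ only_trivial_extension_closed R.
Proof.
move=> maxm.
have [k] := ubnP (size s); elim: k S f s => // k IH S f.
case=> [//|a [//|b [|c s]]] sk fsurj _ reg kerf sW.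
  apply: (nontrivial_extension_closed_of_two_relations maxm fsurj reg kerf);
    by apply: sW; rewrite !inE eqxx ?orbT.
have [B [p [h [psurj kerp hp kerh regB]]]] := regular_quotient_step fsurj kerf reg.
apply: (IH B h (map p [:: b, c & s])) => //; first by rewrite size_map.
  by move=> y; have [x <-] := fsurj y; exists (p x).
move=> _ /mapP[d ds ->]; apply: prod_add_map (sW d _) => [y|]; first by rewrite hp.
by rewrite inE ds orbT.
Qed.

Lemma regular_presentation_reduce (R : comNzRingType) (m : idealr R)
    (S : comNzRingType) (n : idealr S) (f : {rmorphism S -> R}) s :
  is_local_max (fun x => x \in m) -> only_trivial_extension_closed R ->
  regular_local_ring n -> (forall y, exists x, f x = y) ->
  regular_on (@zero_ideal S) s ->
  (forall x, f x = 0 <-> add_span (@zero_ideal S) s x) ->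
  exists (S' : comNzRingType) (n' : idealr S') (g : S') (f' : {rmorphism S' -> R}),
    [/\ regular_local_ring n', forall y, exists x, f' x = y &
      forall x, f' x = 0 <-> add_span (@zero_ideal S') [:: g] x].
Proof.
move=> maxm triv.
have [k] := ubnP (size s); elim: k S n f s => // k IH S n f s.
rewrite ltnS => sk regn fsurj reg kerf.
have i0 := zero_is_ideal S.
have [noeth locn _] := regn.
have maxn := local_ring_is_local_max noeth locn.
have iW := idealr_is_ideal n.
have sn a : a \in s -> a \in n.
  move=> ains; apply: contrapT; case: maxn => _ _ u /u[z hz].
  have /kerf fa : add_span (@zero_ideal S) s a by apply: add_span_mem.
  by have /eqP := rmorph1 f; rewrite -hz rmorphM fa mulr0 eq_sym oner_eq0.
have nm x : x \in n -> f x \in m.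
  move=> xn; apply: contrapT; case: maxm => _ _ u /u[z hz].
  have [y ey] := fsurj z.
  have /kerf : f (y * x - 1) = 0 by rewrite rmorphB rmorphM ey hz rmorph1 subrr.
  move=> h; have : y * x - 1 \in n.
    by apply: (add_span_sub (I := fun x => x \in n)) h => // _ ->; apply: idealr0.
  move=> h1; have : (1 : S) \in n.
    by rewrite -(subKr (y * x) 1); apply: rpredB => //; apply: idealMr.
  by rewrite idealr1.
have [sq|/existsNP[a /not_implyP[ains na]]] := pselect (forall a, a \in s ->
    prod_add (fun x => x \in n) (fun x => x \in n) (@zero_ideal S) a).
  have [s2|s1] := ltnP 1 (size s).
    case: (nontrivial_extension_closed_of_many_relations maxm fsurj s2 reg kerf) => //.
    move=> a /sq ha; have := prod_add_map (f := idfun) (W' := fun x => f x \in m) _ ha.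
    by apply.
  exists S, n, s`_0, f; split=> // x; rewrite kerf.
  case: (s) s1 => [|b []] //= _; rewrite /add_span /= /zero_ideal.
  by split=> [->|[r [_ <-]]]; [exists 0|]; rewrite ?mulr0 subr0.
have [s1 [s2 es]] : exists s1 s2, s = s1 ++ a :: s2.
  by case/splitPr: ains => s1 s2; exists s1, s2.
have reg' : regular_on (@zero_ideal S) (a :: s1 ++ s2).
  apply: (regular_on_move_front noeth maxn) => //; last by rewrite -es.
  by move=> b bs; apply: sn; rewrite es mem_cat bs.
have kerf' x : f x = 0 <-> add_span (@zero_ideal S) (a :: s1 ++ s2) x.
  rewrite kerf es (add_span_eq (t := a :: s1 ++ s2)) // => y.
  by rewrite !(mem_cat, inE) orbCA.
have [B [p [h [psurj kerp hp kerh regB]]]] := regular_quotient_step fsurj kerf' reg'.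
have [n' [regn' _]] := regular_local_quotient psurj kerp regn (sn a ains) reg'.1 na.
apply: (IH B n' h (map p (s1 ++ s2))) => //.
  by apply: leq_trans sk; rewrite size_map es !size_cat /= addnS.
by move=> y; have [x <-] := fsurj y; exists (p x).
Qed.

(** * Nilpotency of the maximal ideal, the Artinian condition, principality *)

Section NilpotentMaximalIdeal.
Variables (R : comNzRingType) (m : idealr R).

Lemma ideal_exp_pow n x : x \in m -> x ^+ n.+1 \in ideal_exp m n.
Proof.
move=> xm; elim: n => [|n IH]; first by rewrite expr1.
apply: asboolT; exists [:: (x, x ^+ n.+1)]; rewrite big_seq1 -exprS; split=> // p.
by rewrite inE => /eqP->.
Qed.

(** The nested sums in [ideal_exp] are unrolled one level at a time; the list s accumulates the
    factors already extracted. *)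
Lemma ideal_exp_nilpotent k :
  (forall s : seq R, (k <= size s)%N -> (forall x, x \in s -> x \in m) ->
     \prod_(x <- s) x = 0) ->
  forall x, x \in ideal_exp m k -> x = 0.
Proof.
move=> mk.
have h n : forall (s : seq R) x, (k <= size s + n.+1)%N ->
    (forall x, x \in s -> x \in m) -> x \in ideal_exp m n -> \prod_(y <- s) y * x = 0.
  elim: n => [|n IH] s x ks sm.
    move=> xm; have := mk (rcons s x); rewrite size_rcons -cats1 big_cat big_seq1 /=.
    apply; first by rewrite -addn1.
    by move=> y; rewrite mem_cat inE => /orP[/sm|/eqP->].
  move=> /asboolW[t [ht ->]]; rewrite mulr_sumr big_seq big1 // => p /ht[p1 p2].
  rewrite mulrA -[_ * p.1](_ : \prod_(y <- rcons s p.1) y = _); last first.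
    by rewrite -cats1 big_cat big_seq1.
  apply: IH => //; first by rewrite size_rcons addSnnS.
  by move=> y; rewrite mem_rcons inE => /orP[/eqP->|/sm].
move=> x xk; have := h k [::] x; rewrite big_nil mul1r; exact.
Qed.

(** The condition m^k M = 0, phrased by lists so that k = 0 is allowed and products split along
    concatenation. In an extension the exponents add. *)
Definition killed_by_power (M : lmodType R) : Prop :=
  exists k, forall s : seq R, (k <= size s)%N -> (forall x, x \in s -> x \in m) ->
    forall v : M, \prod_(x <- s) x *: v = 0.

Lemma extension_closed_killed_by_power :
  extension_closed (fun M => fin_gen M /\ killed_by_power M).
Proof.
split.
- split.
  + exists 'rV[R]_0; split; first exact: fin_gen_row.
    by exists 0%N => s _ _ v; apply/rowP => -[].
  + by move=> M [].
  + move=> M N MN [fM [k hk]]; split; first exact: mod_iso_fin_gen MN fM.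
    have [f [g _ gK]] := MN; exists k => s ks sm v.
    by rewrite -(gK v) -linearZ /= hk // linear0.
- move=> M N [fMN [k hk]]; split.
    by apply: (fin_gen_image (f := fst)) fMN => x; exists (x, 0).
  by exists k => s ks sm v; have /(congr1 fst) := hk s ks sm (v, 0).
- move=> L M N f g fM [finj fg gsurj] [fL [k hk]] [fN [l hl]]; split=> //.
  exists (k + l)%N => s ks sm v.
  rewrite -(cat_take_drop k s) big_cat /= -scalerA.
  have [x hx] : exists x, f x = \prod_(x <- drop k s) x *: v.
    apply/fg; rewrite linearZ /= hl //; first by rewrite size_drop leq_subRL // (leq_trans _ ks) ?leq_addr.
    by move=> x /mem_drop/sm.
  rewrite -hx -linearZ /= hk ?linear0 //; last by move=> y /mem_take/sm.
  by rewrite size_takel // (leq_trans _ ks) // leq_addr.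
Qed.

(** The class contains R/m, so it is not the zero class. If it is the class of free modules, then
    R/m is free and nonzero, which forces m = 0. Otherwise it contains R, which says that m is
    nilpotent. *)
Lemma only_trivial_nilpotent :
  only_trivial_extension_closed R ->
  exists k, forall x, x \in ideal_exp m k -> x = 0.
Proof.
move=> triv.
suff [k hk] : exists k, forall s : seq R, (k <= size s)%N ->
    (forall x, x \in s -> x \in m) -> \prod_(x <- s) x = 0.
  by exists k; apply: ideal_exp_nilpotent.
have sm : is_submod (V := R^o) (fun x => x \in m) by exact: (idealr_is_ideal m).
have [Q [p [psurj kerp]]] := exists_quotient_module sm.
have mQ x (v : Q) : x \in m -> x *: v = 0.
  move=> xm; have [y <-] := psurj v.
  by rewrite -linearZ; apply/kerp; rewrite /GRing.scale /= mulrC; apply: idealMr.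
have XQ : fin_gen Q /\ killed_by_power Q.
  split; first exact: fin_gen_image psurj (fin_gen_regular R).
  exists 1%N => -[//|x s] _ hs v; rewrite big_cons mulrC -scalerA (mQ x) ?scaler0 //.
  by apply: hs; rewrite mem_head.
have p1 : p 1 <> 0 by move/kerp; rewrite idealr1.
have [h|h|h] := triv _ extension_closed_killed_by_power.
- by case: p1; apply: ((h Q).1 XQ).
- have [n [f [g fK gK]]] := (h Q).1 XQ.
  exists 1%N => -[//|x s] _ hs; rewrite big_cons.
  suff -> : x = 0 by rewrite mul0r.
  case: n => [|n] in f g fK gK *.
    by case: p1; rewrite -(gK (p 1)) (_ : g _ = 0) ?linear0 //; apply/rowP => -[].
  have e : x *: (delta_mx 0 0 : 'rV[R]_n.+1) = 0.
    apply: (can_inj fK); rewrite linearZ /= linear0; apply: mQ.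
    by apply: hs; rewrite mem_head.
  by have := congr1 (fun v : 'rV_n.+1 => v 0 0) e; rewrite !mxE eqxx mulr1.
- have [_ [k hk]] := (h R^o).2 (fin_gen_regular R).
  by exists k => s ks hs; have := hk s ks hs 1; rewrite /GRing.scale /= mulr1.
Qed.

(** Every prime contains the nilpotent ideal m, so m is minimal over 0 and descending chains
    stabilise locally at m, that is, in R. *)
Lemma nilpotent_artinian k : noetherian R -> is_local_max (fun x => x \in m) ->
  (forall x, x \in ideal_exp m k -> x = 0) -> artinian R.
Proof.
move=> noeth maxm mk I Idec; have i0 := zero_is_ideal R.
have [||||i hi] := @dcc_at_minimal_prime R (fun x => x \in m) (@zero_ideal R)
  (fun i x => x \in I i) noeth (local_max_prime maxm).
- exact: i0.
- move=> Q pQ _ _ x xm; apply: (prime_expr (k := k.+1)) => //.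
  by rewrite (mk (x ^+ k.+1)) ?ideal_exp_pow //; exact: is_ideal0 (prime_ideal pQ).
- by move=> i; apply: idealr_is_ideal.
- exact: Idec.
exists i => j ij x; apply/idP/idP => [|xi].
  by move: ij => /subnK <-; elim: (j - i)%N => // d IH /Idec.
have iIj := idealr_is_ideal (I j).
have [a [_ [Ia -> ->]]] := local_max_saturation maxm (sum_is_ideal iIj i0) (hi j x xi).
by rewrite addr0.
Qed.

(** The powers of m stabilise, so some power I satisfies I = m I and vanishes by Nakayama's
    lemma. *)
Lemma artinian_nilpotent : noetherian R -> is_local_max (fun x => x \in m) ->
  artinian R -> exists k, forall x, x \in ideal_exp m k -> x = 0.
Proof.
move=> noeth maxm art.
have [|k hk] := art (ideal_exp m).
  by move=> n x /asboolW[s [hs ->]]; rewrite big_seq; apply: rpred_sum => p /hs[_ h]; apply: idealMr.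
exists k => x xk; have i0 := zero_is_ideal R.
have [||t [nt ht]] := nakayama noeth (local_max_prime maxm) (idealr_is_ideal m)
  (idealr_is_ideal (ideal_exp m k)) i0.
- by [].
- move=> z; rewrite -(hk k.+1) // => /asboolW[s [hs ->]].
  apply: saturation_sub; first exact: local_max_prime.
  move=> I iI _ h; rewrite big_seq; elim/big_ind: _ => [|u v|p /hs[h1 h2]].
  + exact: is_ideal0.
  + exact: is_idealD.
  + exact: h.
by apply: (local_max_saturation maxm i0); exists t; split=> //; apply: ht.
Qed.

(** A regular S of dimension at least 2 would have, by Krull's theorem, a prime T that contains g
    and is strictly below n. Nilpotency of m puts a power of each element of n into (g), hence n
    into T. So n has at most one generator, whose image generates m. *)
Lemma hypersurface_principal k (S : comNzRingType) (n : idealr S)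
    (f : {rmorphism S -> R}) g :
  is_local_max (fun x => x \in m) -> (forall x, x \in ideal_exp m k -> x = 0) ->
  regular_local_ring n -> (forall y, exists x, f x = y) ->
  (forall x, f x = 0 <-> add_span (@zero_ideal S) [:: g] x) ->
  exists2 x, x \in m & forall r, r \in m -> exists c, r = c * x.
Proof.
move=> maxm mk [noeth locn [s [ns [chain nchain]]]] fsurj kerf.
have maxn := local_ring_is_local_max noeth locn.
have i0 := zero_is_ideal S.
have iW := idealr_is_ideal n.
have fg : f g = 0 by apply/kerf; apply: add_span_mem; rewrite ?mem_head.
have gn : g \in n.
  apply: contrapT; case: maxn => _ _ u /u[z hz].
  by have /eqP := rmorph1 f; rewrite -hz rmorphM fg mulr0 eq_sym oner_eq0.
have nm x : x \in n -> f x \in m.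
  move=> xn; apply: contrapT; case: maxm => _ _ u /u[z hz].
  have [y ey] := fsurj z.
  have /kerf[r [_ e]] : f (y * x - 1) = 0 by rewrite rmorphB rmorphM ey hz rmorph1 subrr.
  have : (1 : S) \in n.
    rewrite (_ : 1 = y * x - r * g); first by apply: rpredB; apply: idealMr.
    have e' : y * x - 1 - r * g = 0 := e.
    by rewrite -[LHS]addr0 -[0]e'; ring.
  by rewrite idealr1.
have s_le1 : (size s <= 1)%N.
  rewrite leqNgt; apply/negP => s2.
  have /prime_chainE[Q cQ] := chain.
  have [pQ sQ] := is_chain_take s2 cQ.
  have [h1 h2] := sQ 0%N isT; have [h3 h4] := sQ 1%N isT.
  have Qn y : Q 2 y -> y \in n.
    by have [iQ nQ _] := pQ 2 isT; exact: (local_max_proper maxn iQ nQ).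
  have [||T [pT _ Tg _ nT]] := krull_principal noeth (pQ 0%N isT) (pQ 1%N isT)
    (local_max_prime maxn) h1 _ h2 _ gn.
  - by move=> y /h3/Qn.
  - by move=> h; apply: h4 => y /Qn/h.
  apply: nT => y yn; apply: (prime_expr (k := k.+1)) => //.
  have /kerf : f (y ^+ k.+1) = 0 by rewrite rmorphXn; apply: mk; apply/ideal_exp_pow/nm.
  apply: add_span_sub; first by case: pT.
    by move=> _ ->; exact: is_ideal0 (prime_ideal pT).
  by move=> b; rewrite inE => /eqP->.
have [a an na] : exists2 a, a \in n & forall y, y \in n -> exists c, y = c * a.
  have nsE y : y \in n <-> add_span (@zero_ideal S) s y by rewrite -in_spanE; apply: ns.
  case: (s) s_le1 nsE => [|a []] // _ nsE.
    by exists 0 => [|y /nsE ->]; [exact: idealr0|exists 0; rewrite mulr0].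
  exists a; first by apply/nsE/add_span_mem; rewrite ?mem_head.
  by move=> y /nsE[c [_ e]]; exists c; apply/eqP; rewrite -subr_eq0; apply/eqP.
exists (f a); first exact: nm.
move=> r rm; have [y ey] := fsurj r.
have yn : y \in n.
  apply: contrapT; case: maxn => _ _ u /u[z hz].
  have : (1 : R) \in m by rewrite -(rmorph1 f) -hz rmorphM ey; apply: idealMr.
  by rewrite idealr1.
by have [c ec] := na y yn; exists (f c); rewrite -rmorphM -ec.
Qed.

End NilpotentMaximalIdeal.

(** * Direct sums in extension-closed subcategories *)

Section Products.
Variable R : comNzRingType.
Implicit Types M N : lmodType R.

Lemma exists_inr M N : exists f : {linear N -> (M * N)%type}, forall x, f x = (0, x).
Proof.
apply: (@linear_of R N (M * N)%type (fun x => (0, x))) => a x y.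
by congr pair; rewrite /= scaler0 addr0.
Qed.

Lemma in_span_linear_inj M N (f : {linear M -> N}) s x :
  (forall y, f y = 0 -> y = 0) -> in_span (map f s) (f x) -> in_span s x.
Proof.
move=> finj; elim: s x => [|a s IH] x /=.
  by move/in_span_nil/finj->; apply/in_span_nil.
move/in_span_cons=> [r]; rewrite -linearZ -linearB => /IH h.
by apply/in_span_cons; exists r.
Qed.

Lemma in_span_subset M (s t : seq M) x :
  {subset s <= t} -> in_span s x -> in_span t x.
Proof.
move=> st; apply: in_span_sub; first exact: in_span_submod.
by move=> a /st/in_span_mem.
Qed.

Lemma fin_gen_prod M N : fin_gen M -> fin_gen N -> fin_gen (M * N)%type.
Proof.
move=> [s hs] [t ht]; have [f fE] := exists_inl M N; have [g gE] := exists_inr M N.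
exists (map f s ++ map g t) => -[x y].
have [_ hD _] := in_span_submod (map f s ++ map g t).
have -> : (x, y) = f x + g y by rewrite fE gE; congr pair; rewrite /= ?addr0 ?add0r.
apply: hD.
  apply: (in_span_subset (s := map f s)); last exact: in_span_linear.
  by move=> z; rewrite mem_cat => ->.
apply: (in_span_subset (s := map g t)); last exact: in_span_linear.
by move=> z; rewrite mem_cat => ->; rewrite orbT.
Qed.

Lemma mod_iso_prod M M' N N' :
  mod_iso M M' -> mod_iso N N' -> mod_iso (M * N)%type (M' * N')%type.
Proof.
move=> [f [f' fK f'K]] [g [g' gK g'K]].
have [|h hE] := @linear_of R (M * N)%type (M' * N')%type (fun x => (f x.1, g x.2)).
  by move=> a x y; congr pair; rewrite /= linearP.
exists h; exists (fun x => (f' x.1, g' x.2)) => -[x y]; rewrite hE /=.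
  by rewrite fK gK.
by rewrite f'K g'K.
Qed.

Lemma mod_iso_row p q : mod_iso ('rV[R]_p * 'rV[R]_q)%type 'rV[R]_(p + q).
Proof.
have [|h hE] := @linear_of R ('rV[R]_p * 'rV[R]_q)%type 'rV[R]_(p + q)
  (fun x => row_mx x.1 x.2).
  by move=> a x y; rewrite /= scale_row_mx add_row_mx.
exists h; exists (fun x => (lsubmx x, rsubmx x)) => x; rewrite hE /=.
  by rewrite row_mxKl row_mxKr; case: x.
by rewrite hsubmxK.
Qed.

Lemma mod_iso_prodC M N : mod_iso (M * N)%type (N * M)%type.
Proof.
have [|h hE] := @linear_of R (M * N)%type (N * M)%type (fun x => (x.2, x.1)).
  by move=> a x y.
by exists h; exists (fun x => (x.2, x.1)) => -[x y]; rewrite hE.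
Qed.

Lemma mod_iso_zero_prod M N : zero_module N -> mod_iso M (N * M)%type.
Proof.
move=> N0; have [f fE] := exists_inr N M.
apply: (mod_iso_of (f := f)) => [x|[y x]]; first by rewrite fE => -[].
by exists x; rewrite fE (N0 y).
Qed.

Variable X : lmodType R -> Prop.
Hypothesis extX : extension_closed X.

Lemma ext_iso M N : mod_iso M N -> X M -> X N.
Proof. by case: extX => -[_ _ h _ _]; apply: h. Qed.

Lemma ext_fin_gen M : X M -> fin_gen M.
Proof. by case: extX => -[_ h _ _ _]; apply: h. Qed.

Lemma ext_summand_l M N : X (M * N)%type -> X M.
Proof. by case: extX => _ h _; apply: h. Qed.

Lemma ext_summand_r M N : X (M * N)%type -> X N.
Proof. by move=> h; apply: ext_summand_l (ext_iso (mod_iso_prodC M N) h). Qed.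

Lemma ext_prod M N : X M -> X N -> X (M * N)%type.
Proof.
move=> XM XN; case: extX => _ _ h; have [f fE] := exists_inl M N.
apply: (h M (M * N)%type N f snd) => //.
  by apply: fin_gen_prod; apply: ext_fin_gen.
split=> [x y|[x y]|z]; first by rewrite !fE => -[].
  by split=> [/= ->|[u]]; [exists x|rewrite fE => -[]].
by exists (0, z).
Qed.

(** Nonemptiness of X enters here: any N in X is isomorphic to M + N, of which M is a summand. *)
Lemma ext_zero M : zero_module M -> X M.
Proof.
move=> M0; case: (extX) => -[[N XN] _ _] _ _.
apply: (ext_summand_l (N := N)); exact: ext_iso (mod_iso_zero_prod N M0) XN.
Qed.

End Products.

(** * Modules over an Artinian principal local ring *)

Section Uniserial.
Variables (R : comNzRingType) (m : idealr R) (x : R) (n : nat).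
Hypothesis maxm : is_local_max (fun y => y \in m).
Hypothesis genm : forall r, r \in m -> exists c, r = c * x.
Hypothesis xn : x ^+ n = 0.
Hypothesis xlt : forall i, (i < n)%N -> x ^+ i <> 0.
Implicit Types M N V : lmodType R.

(** The x-adic valuation of r, truncated at k: factors x are split off until the cofactor is a unit
    or k is reached. *)
Lemma uniserial_elt k r :
  (exists u i, [/\ (i < k)%N, u \notin m & r = u * x ^+ i]) \/
  exists c, r = c * x ^+ k.
Proof.
elim: k => [|k [[u [i [ik um ->]]]|[c ->]]]; first by right; exists r; rewrite mulr1.
  by left; exists u, i; split=> //; apply: ltnW.
have [/genm[d ->]|cm] := boolP (c \in m).
  by right; exists d; rewrite exprS mulrA.
by left; exists c, k.
Qed.

(** If t had valuation i < b, dividing by its unit part would put x^i v into N. *)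
Lemma uniserial_order V (N : V -> Prop) b v t : is_submod N ->
  (forall i, (i < b)%N -> ~ N (x ^+ i *: v)) -> N (t *: v) ->
  exists c, t = c * x ^+ b.
Proof.
move=> [_ _ NZ] nN; have [[u [i [ib um ->]]]|//] := uniserial_elt b t.
have [y hy] : exists y, y * u = 1 by case: maxm => _ _; apply; apply/negP.
move=> /(NZ y); rewrite scalerA mulrA hy mul1r => h.
by case: (nN i ib).
Qed.

Lemma zero_submod V : is_submod (fun v : V => v = 0).
Proof. by split=> // [u v -> ->|a v ->]; rewrite ?addr0 ?scaler0. Qed.

Lemma uniserial_ann a r : (a <= n)%N -> x ^+ a * r = 0 -> exists c, r = c * x ^+ (n - a).
Proof.
move=> an h.
apply: (@uniserial_order R^o (fun v => v = 0) (n - a) (x ^+ a) r (zero_submod _)).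
  move=> i ib; rewrite /GRing.scale /= -exprD; apply: xlt.
  by rewrite addnC -ltn_subRL.
by rewrite /GRing.scale /= mulrC.
Qed.

(* As x^n = 0, the ideal 0 : x^a = x^(n-a) R is a model of R/(x^a). *)
Definition ann_module a M : Prop := exists i : {linear M -> R^o},
  (forall y, i y = 0 -> y = 0) /\ forall v, x ^+ a * v = 0 <-> exists y, i y = v.

Lemma exists_ann_module a : exists M, ann_module a M.
Proof.
have [|M [i [iinj hi]]] := @exists_submodule R R^o (fun v => x ^+ a * v = 0).
  split; first by rewrite mulr0.
    by move=> u v hu hv; rewrite mulrDr hu hv addr0.
  by move=> b v hv; rewrite /GRing.scale /= mulrCA hv mulr0.
by exists M, i.
Qed.

(** Maps into the model of R/(x^a) are maps into R with values killed by x^a; all maps between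
    models are built this way. *)
Lemma ann_module_lift a M (i : {linear M -> R^o}) V (h : {linear V -> R^o}) :
  (forall y, i y = 0 -> y = 0) -> (forall v, x ^+ a * v = 0 <-> exists y, i y = v) ->
  (forall v, x ^+ a * h v = 0) -> exists h' : {linear V -> M}, forall v, i (h' v) = h v.
Proof.
move=> iinj iE hE; have /choice[k hk] v : exists y, i y = h v by apply/iE.
have [|h' h'E] := @linear_of R V M k.
  move=> b u v; apply/eqP; rewrite -subr_eq0; apply/eqP/iinj.
  by rewrite linearB linearP /= !hk linearP subrr.
by exists h' => v; rewrite h'E.
Qed.

Lemma ann_module_unique a M N : ann_module a M -> ann_module a N -> mod_iso M N.
Proof.
move=> [i [iinj iE]] [j [jinj jE]].
have [|h hE] := ann_module_lift (h := i) jinj jE; first by move=> v; apply/iE; exists v.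
apply: (mod_iso_of (f := h)) => [y hy|y]; first by apply: iinj; rewrite -hE hy linear0.
have [|z hz] := (iE (j y)).1; first by apply/jE; exists y.
exists z; apply/eqP; rewrite -subr_eq0; apply/eqP/jinj.
by rewrite linearB /= hE hz subrr.
Qed.

Lemma exists_mul V (z : V) : exists f : {linear R^o -> V}, forall r : R, f r = r *: z.
Proof.
apply: (@linear_of R R^o V (fun r => r *: z)) => a u v.
by rewrite scalerDl scalerA.
Qed.

Lemma ann_module_cyclic a M (i : {linear M -> R^o}) : (a <= n)%N ->
  (forall y, i y = 0 -> y = 0) -> (forall v, x ^+ a * v = 0 <-> exists y, i y = v) ->
  exists p : {linear R^o -> M},
    (forall y, exists r, p r = y) /\ forall r : R, i (p r) = r * x ^+ (n - a).
Proof.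
move=> an iinj iE; have [f fE] := @exists_mul R^o (x ^+ (n - a)).
have [|p pE] := ann_module_lift (h := f) iinj iE.
  by move=> v; rewrite fE /GRing.scale /= mulrCA -exprD subnKC // xn mulr0.
exists p; split=> [y|r]; last by rewrite pE fE.
have [c hc] := uniserial_ann an ((iE (i y)).2 (ex_intro _ y erefl)).
exists c; apply/eqP; rewrite -subr_eq0; apply/eqP/iinj.
by rewrite linearB /= pE fE hc subrr.
Qed.

Lemma ann_module_fin_gen a M : (a <= n)%N -> ann_module a M -> fin_gen M.
Proof.
move=> an [i [iinj iE]]; have [p [psurj _]] := ann_module_cyclic an iinj iE.
exact: fin_gen_image psurj (fin_gen_regular R).
Qed.

(* 0 -> R/x^a -> R/x^(a-1) * R/x^(a+1) -> R/x^a -> 0 *)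
Lemma ext_ann_module_neighbours (X : lmodType R -> Prop) a M M1 M2 :
  extension_closed X -> (0 < a < n)%N ->
  ann_module a M -> ann_module a.-1 M1 -> ann_module a.+1 M2 ->
  X M -> X M1 /\ X M2.
Proof.
move=> extX /andP[a0 an] cM cM1 cM2 XM.
suff h : X (M1 * M2)%type by split; [apply: ext_summand_l h|apply: ext_summand_r h].
have fM1 : fin_gen M1 by apply: ann_module_fin_gen cM1; apply: leq_trans (leq_pred a) (ltnW an).
have fM2 : fin_gen M2 by apply: ann_module_fin_gen cM2.
move: cM cM1 cM2 => [i [iinj iE]] [i1 [i1inj i1E]] [i2 [i2inj i2E]].
have xi v : x ^+ a * i v = 0 by apply/iE; exists v.
have xi1 v : x ^+ a.-1 * i1 v = 0 by apply/i1E; exists v.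
have xi2 v : x ^+ a.+1 * i2 v = 0 by apply/i2E; exists v.
have eqv V (j : {linear V -> R^o}) u v : (forall y, j y = 0 -> y = 0) -> j u = j v -> u = v.
  move=> jinj e; apply/eqP; rewrite -subr_eq0; apply/eqP/jinj.
  by rewrite linearB /= e subrr.
have xa v : x ^+ a * v = x ^+ a.-1 * (x * v) by rewrite mulrA -exprSr prednK.
(* Inside R the sequence is u |-> (x u, u) followed by (p, q) |-> p - x q, between the annihilators
   of x^(a-1), x^a and x^(a+1). *)
have [|mx mxE] := @linear_of R M R^o (fun v => x *: i v).
  by move=> b u v; rewrite linearP scalerDr !scalerA mulrC.
have [|f1 f1E] := ann_module_lift (h := mx) i1inj i1E.
  by move=> v; rewrite mxE -xa.
have [|f2 f2E] := ann_module_lift (h := i) i2inj i2E.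
  by move=> v; rewrite exprS -mulrA xi mulr0.
have [|f fE] := @linear_of R M (M1 * M2)%type (fun u => (f1 u, f2 u)).
  by move=> b u v; congr pair; rewrite linearP.
have [|d dE] := @linear_of R (M1 * M2)%type R^o (fun pq => i1 pq.1 - x *: i2 pq.2).
  move=> b u v; rewrite /= (linearP i1) (linearP i2) scalerDr scalerBr !scalerA [x * b]mulrC.
  by rewrite opprD addrACA.
have [|g gE] := ann_module_lift (h := d) iinj iE.
  move=> [p q]; rewrite dE mulrBr xa mulrCA xi1 mulr0.
  by rewrite /GRing.scale /= mulrA -exprSr xi2 subr0.
case: (extX) => _ _ /(_ M (M1 * M2)%type M f g); apply=> //; first exact: fin_gen_prod.
split.
- move=> u v; rewrite !fE => -[_ e2]; apply: (eqv _ i) => //.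
  by rewrite -!f2E e2.
- move=> [p q]; split=> [e|[u]]; last first.
    rewrite fE => -[<- <-]; apply: iinj.
    by rewrite gE dE /= f1E f2E mxE subrr.
  have e' : i1 p = x * i2 q.
    by have := congr1 i e; rewrite gE dE linear0 => /eqP; rewrite subr_eq0 => /eqP.
  have [|u hu] := (iE (i2 q)).1; first by rewrite xa -e' xi1.
  exists u; rewrite fE; congr pair; first by apply: (eqv _ i1) => //; rewrite f1E mxE hu e'.
  by apply: (eqv _ i2) => //; rewrite f2E.
- move=> z; have [c hc] := uniserial_ann (ltnW an) (xi z).
  (* As a < n, the element z = c x^(n-a) is x times c x^(n-a-1), so (0, q) with this negative q maps
     to z. *)
  have [|q hq] := (i2E (- (c * x ^+ (n - a).-1))).1.
    rewrite mulrN mulrCA -exprD addSnnS prednK ?subn_gt0 //.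
    by rewrite subnKC ?xn ?mulr0 ?oppr0 // ltnW.
  exists (0, q); apply: (eqv _ i) => //; rewrite gE dE /= linear0 sub0r hq hc.
  by rewrite /GRing.scale /= mulrN opprK mulrCA -exprS prednK ?subn_gt0.
Qed.

Lemma ext_all_ann_modules (X : lmodType R -> Prop) a M : extension_closed X ->
  (0 < a < n)%N -> ann_module a M -> X M ->
  forall b N, (b <= n)%N -> ann_module b N -> X N.
Proof.
move=> extX /andP[a0 an] cM XM.
pose P b := forall N, ann_module b N -> X N.
have Pa : P a by move=> N cN; apply: (ext_iso extX _ XM); apply: ann_module_unique cM cN.
have step b : (0 < b < n)%N -> P b -> P b.-1 /\ P b.+1.
  move=> bn Pb; have [N cN] := exists_ann_module b; have XN := Pb N cN.
  have [N1 cN1] := exists_ann_module b.-1; have [N2 cN2] := exists_ann_module b.+1.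
  split=> N' cN'.
    by have [] := ext_ann_module_neighbours extX bn cN cN' cN2 XN.
  by have [] := ext_ann_module_neighbours extX bn cN cN1 cN' XN.
have down k : P (a - k)%N.
  elim: k => [|k IH]; first by rewrite subn0.
  have [e|h] := posnP (a - k)%N.
    by rewrite subnS e /= -e.
  have [|h1 _] := step _ _ IH; last by rewrite subnS.
  by rewrite h (leq_ltn_trans (leq_subr _ _) an).
have up k : (a + k <= n)%N -> P (a + k)%N.
  elim: k => [|k IH]; first by rewrite addn0.
  rewrite addnS => akn; have [|_ //] := step _ _ (IH (ltnW akn)).
  by rewrite addn_gt0 a0 akn.
move=> b N bn; have [ab|ba] := leqP a b.
  by have := up (b - a)%N; rewrite subnKC // => /(_ bn N); apply.
by have := down (a - b)%N N; rewrite (subKn (ltnW ba)); apply.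
Qed.

(* Each generator is corrected by a multiple of [z], an element of maximal
   order, until the submodule it generates meets Rz trivially. *)
Lemma uniserial_complement V a (z : V) s :
  (forall v : V, x ^+ a *: v = 0) -> (forall i, (i < a)%N -> x ^+ i *: z <> 0) ->
  exists s', [/\ (size s' <= size s)%N,
    forall t, in_span s' (t *: z) -> t *: z = 0 &
    forall v, v \in s -> exists t, in_span s' (v - t *: z)].
Proof.
move=> xa za; elim: s => [|v s [s' [ss' dir cov]]].
  by exists [::]; split=> // t /in_span_nil.
have sN := in_span_submod s'; have [N0 ND NZ] := sN.
pose N2 w := exists t, in_span s' (w - t *: z).
have sN2 : is_submod N2.
  split; first by exists 0; rewrite scale0r subr0.
    move=> w w' [t ht] [t' ht']; exists (t + t').
    by rewrite scalerDl opprD addrACA; apply: ND.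
  by move=> b w [t ht]; exists (b * t); rewrite -scalerA -scalerBr; apply: NZ.
have exb : exists b, `[< N2 (x ^+ b *: v) >].
  by exists a; apply: asboolT; rewrite xa; case: sN2.
case: (ex_minnP exb) => b /asboolW[r hr] bmin.
have ba : (b <= a)%N by apply: bmin; apply: asboolT; rewrite xa; case: sN2.
have nN2 i : (i < b)%N -> ~ N2 (x ^+ i *: v).
  by move=> ib h; have := bmin i (asboolT h); rewrite leqNgt ib.
(* If r had valuation i < b, multiplying x^b v - r z by x^(a-b) would give x^(a-b+i) z = 0, although
   z has order a. So r = c x^b, and v - c z is the corrected generator. *)
have [c ec] : exists c, r = c * x ^+ b.
  have [[u [i [ib um er]]]|//] := uniserial_elt b r.
  have h0 : (x ^+ (a - b) * r) *: z = 0.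
    apply: dir; have := NZ (- x ^+ (a - b)) _ hr.
    by rewrite scalerBr !scalerA !mulNr -exprD subnK // !scaleNr xa opprK oppr0 add0r.
  have [y hy] : exists y, y * u = 1 by case: maxm => _ _; apply; apply/negP.
  case: (za (a - b + i)%N).
    by rewrite -ltn_subRL subKn.
  rewrite -(scale1r (_ *: z)) -hy scalerA -mulrA [u * _](_ : _ = x ^+ (a - b) * r).
    by rewrite -scalerA h0 scaler0.
  by rewrite er exprD mulrCA.
pose v' := v - c *: z.
have hv' : in_span s' (x ^+ b *: v').
  by rewrite scalerBr scalerA mulrC -ec.
exists (v' :: s'); split=> //.
- move=> t /in_span_cons[t' ht'].
  (* By minimality of b, the coefficient t' is a multiple of x^b, and x^b v' already lies in the
     span of s'. *)
  have [d ed] : exists d, t' = d * x ^+ b.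
    apply: (uniserial_order sN2 nN2); exists (t + t' * c).
    have -> : t' *: v - (t + t' * c) *: z = -1 *: (t *: z - t' *: v').
      by rewrite scaleN1r scalerDl scalerBr scalerA opprB opprD addrA addrAC.
    exact: NZ.
  apply: dir; rewrite -(subrK (t' *: v') (t *: z)); apply: ND => //.
  by rewrite ed -scalerA; apply: NZ.
- move=> w; rewrite inE => /orP[/eqP->|/cov[t ht]].
    by exists c; apply: in_span_mem; rewrite mem_head.
  by exists t; apply/in_span_cons; exists 0; rewrite scale0r subr0.
Qed.

(** The decomposition into modules R/(x^a), cast as an induction principle to avoid indexed direct
    sums. With a least such that x^a M = 0, some generator z has order exactly a. The submodule R z
    splits off, with a complement that needs fewer generators. *)
Lemma uniserial_module_ind (Y : lmodType R -> Prop) :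
  (forall M N, mod_iso M N -> Y M -> Y N) -> (forall M, zero_module M -> Y M) ->
  (forall a C N, (0 < a <= n)%N -> ann_module a C -> Y N -> Y (C * N)%type) ->
  forall M, fin_gen M -> Y M.
Proof.
move=> Yiso Y0 Yprod M [l hl].
have [k] := ubnP (size l); elim: k M l hl => // k IH M l hl.
rewrite ltnS => lk.
have exa : exists a, `[< forall v : M, x ^+ a *: v = 0 >].
  by exists n; apply: asboolT => v; rewrite xn scale0r.
case: (ex_minnP exa) => a /asboolW xa amin.
have an : (a <= n)%N by apply: amin; apply: asboolT => v; rewrite xn scale0r.
case: (posnP a) => [a0|a_gt0].
  by apply: Y0 => v; rewrite -(scale1r v) -(expr0 x) -a0.
have [z zl hz] : exists2 z, z \in l & x ^+ a.-1 *: z <> 0.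
  apply: contrapT => /forall2NP h; have : (a <= a.-1)%N.
    apply: amin; apply: asboolT => v.
    apply: (in_span_sub (N := fun v => x ^+ a.-1 *: v = 0)) (hl v).
      split; first by rewrite scaler0.
        by move=> u w hu hw; rewrite scalerDr hu hw addr0.
      by move=> b u hu; rewrite scalerA mulrC -scalerA hu scaler0.
    by move=> u ul; case: (h u) => // /contrapT.
  by rewrite leqNgt ltn_predL a_gt0.
have za i : (i < a)%N -> x ^+ i *: z <> 0.
  move=> ia h; apply: hz; have ia' : (i <= a.-1)%N by rewrite -ltnS prednK.
  by rewrite -(subnK ia') exprD -scalerA h scaler0.
have [l1 [l2 el]] : exists l1 l2, l = l1 ++ z :: l2.
  by case/splitPr: zl => l1 l2; exists l1, l2.
have [s' [ss' dir cov]] := uniserial_complement (l1 ++ l2) xa za.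
have [N [j [jinj jE]]] := exists_submodule (in_span_submod s').
have [C cC] := exists_ann_module a; have [i [iinj iE]] := cC.
have [p [psurj pE]] := ann_module_cyclic an iinj iE.
have [q qE] := exists_mul z.
(* [phi] identifies C, a copy of R/(x^a), with R z, because z has order exactly a. *)
have [r0|phi phip] := linear_factor (g := q) psurj.
  move=> pr0; have [c ->] : exists c, r0 = c * x ^+ a.
    apply: (@uniserial_order R^o (fun v => v = 0) a (x ^+ (n - a)) r0 (zero_submod _)).
      move=> k' ka; rewrite /GRing.scale /= -exprD; apply: xlt.
      by rewrite addnC -ltn_subRL subKn.
    by rewrite /GRing.scale /= -pE pr0 linear0.
  by rewrite qE -scalerA xa scaler0.
have phiinj c : phi c = 0 -> c = 0.
  have [r <-] := psurj c; rewrite phip qE => /(uniserial_order (zero_submod M) za)[d ->].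
  by apply: iinj; rewrite pE -mulrA -exprD subnKC // xn mulr0.
have [|h hE] := @linear_of R (C * N)%type M (fun cy => phi cy.1 + j cy.2).
  by move=> b u v; rewrite /= (linearP phi) (linearP j) scalerDr addrACA.
have hiso : mod_iso (C * N)%type M.
  apply: (mod_iso_of (f := h)) => [[c y]|v].
    rewrite hE /=; have [r er] := psurj c; rewrite -er phip qE => e.
    have rz : r *: z = 0.
      apply: dir; apply/jE; exists (- y).
      by rewrite linearN; apply/eqP; rewrite eq_sym -addr_eq0 e.
    have pr0 : p r = 0 by apply: phiinj; rewrite phip qE.
    by move: e; rewrite rz add0r => /jinj->; rewrite pr0.
  apply: (in_span_sub (N := fun v => exists cy, h cy = v)) (hl v).
    split; first by exists 0; rewrite linear0.
      by move=> _ _ [u <-] [w <-]; exists (u + w); rewrite linearD.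
    by move=> b _ [u <-]; exists (b *: u); rewrite linearZ.
  move=> w; rewrite el mem_cat inE orbCA -mem_cat => /orP[/eqP->|/cov[t ht]].
    by exists (p 1, 0); rewrite hE /= phip qE linear0 addr0 scale1r.
  have [y hy] := (jE _).1 ht.
  by exists (p t, y); rewrite hE /= phip qE hy addrC subrK.
apply: Yiso hiso _; apply: Yprod cC _; first by rewrite a_gt0.
have [t et] : exists t, s' = map j t.
  have : forall w, w \in s' -> exists y, j y = w by move=> w ws; apply/jE/in_span_mem.
  elim: (s') => [|w u IHu] hw; first by exists [::].
  have [t ->] := IHu (fun y yu => hw y (mem_behead (s := w :: u) yu)).
  by have [y <-] := hw w (mem_head _ _); exists (y :: t).
apply: (IH N t).
  by move=> y; apply: (in_span_linear_inj jinj); rewrite -et; apply/jE; exists y.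
by rewrite -(size_map j) -et (leq_ltn_trans ss') // (leq_trans _ lk) // el !size_cat /= addnS.
Qed.

Lemma ann_module_top C : ann_module n C -> mod_iso C 'rV[R]_1.
Proof.
move=> [i [iinj iE]].
have [|f fE] := @linear_of R C 'rV[R]_1 (fun c => const_mx (i c)).
  by move=> a u v; apply/rowP => k; rewrite !mxE linearP.
apply: (mod_iso_of (f := f)) => [c|v].
  by rewrite fE => /rowP/(_ 0); rewrite !mxE => /iinj.
have [|c hc] := (iE (v 0 0)).1; first by rewrite xn mul0r.
by exists c; rewrite fE hc; apply/rowP => k; rewrite mxE [k]ord1.
Qed.

(** If no R/(x^a) with 0 < a < n is in X, all indecomposable summands of its members are copies of
    R, so X consists of free modules. A nonzero member then puts R, hence every finite free module,
    into X. *)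
Lemma uniserial_only_trivial : only_trivial_extension_closed R.
Proof.
move=> X extX.
have [[a [C [an cC XC]]]|hno] :=
  pselect (exists a C, [/\ (0 < a < n)%N, ann_module a C & X C]).
  apply: Or33 => M; split; first exact: ext_fin_gen.
  apply: uniserial_module_ind => [M' N' iMN|M'|b C' N /andP[_ bn] cC' XN].
  - exact: ext_iso.
  - exact: ext_zero.
  - by apply: ext_prod => //; apply: ext_all_ann_modules cC XC _ _ bn cC'.
have Xfree M : X M -> fin_free M.
  move=> XM; have fM := ext_fin_gen extX XM; move: M fM XM.
  apply: (uniserial_module_ind (Y := fun M => X M -> fin_free M)) => [M' N iMN h|M' M0 _|a C N /andP[a0 an] cC h XCN].
  - move=> XN; have [k ik] := h (ext_iso extX (mod_iso_sym iMN) XN).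
    by exists k; apply: mod_iso_trans ik iMN.
  - exact: zero_module_free.
  - have XC := ext_summand_l extX XCN.
    have [k ik] := h (ext_summand_r extX XCN).
    have ean : a = n.
      apply/eqP; rewrite eqn_leq an leqNgt; apply/negP => altn.
      by apply: hno; exists a, C; split=> //; rewrite a0.
    rewrite ean in cC; exists (1 + k)%N.
    apply: mod_iso_trans (mod_iso_sym (mod_iso_row R 1 k)) _.
    by apply: mod_iso_prod => //; apply/mod_iso_sym/ann_module_top.
have [[M [XM nM]]|hz] := pselect (exists M, X M /\ ~ zero_module M); last first.
  apply: Or31 => M; split=> [XM|]; last exact: ext_zero.
  by apply: contrapT => nM; apply: hz; exists M.
apply: Or32 => N; split=> [|[k ik]]; first exact: Xfree.
apply: (ext_iso extX ik).
have X0 : X 'rV[R]_0 by apply: (ext_zero extX) => v; apply/rowP => -[].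
have X1 : X 'rV[R]_1.
  have [[|q] iq] := Xfree M XM.
    case: nM => v; have [f [g _ gK]] := iq.
    by rewrite -(gK v) (_ : g v = 0) ?linear0 //; apply/rowP => -[].
  apply: (ext_summand_l extX (N := 'rV[R]_q)).
  by apply: (ext_iso extX) XM; apply: mod_iso_trans (mod_iso_sym iq) _; apply/mod_iso_sym/mod_iso_row.
elim: (k) => // k' IH; apply: (ext_iso extX (mod_iso_row R 1 k')).
exact: ext_prod.
Qed.

End Uniserial.

Theorem corollary1p14 (R : comNzRingType) (m : idealr R)
    (noethR : noetherian R) (locR : local_ring m)
    (ciR : complete_intersection m) :
  artinian_hypersurface m <-> only_trivial_extension_closed R.
Proof.
have maxm := local_ring_is_local_max noethR locR.
split=> [[artR _ [S [n [g [I [regn Ig iso]]]]]]|triv].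
  have [k mk] := artinian_nilpotent noethR maxm artR.
  have [f [fsurj kerf]] := presentation_of_completion mk Ig iso.
  have [x xm genm] := hypersurface_principal maxm mk regn fsurj kerf.
  have ex0 : exists k, x ^+ k == 0.
    by exists k.+1; apply/eqP/mk/ideal_exp_pow.
  (* The nilpotency index of x is the n of the uniserial theory, where lower powers of x must be
     nonzero. *)
  case: (ex_minnP ex0) => d /eqP xd dmin.
  apply: (uniserial_only_trivial maxm genm xd) => i id /eqP/dmin.
  by rewrite leqNgt id.
have [k mk] := only_trivial_nilpotent m triv.
split=> //; first exact: nilpotent_artinian noethR maxm mk.
have [S [n [s [I [regn regs Is iso]]]]] := ciR.
have [f [fsurj kerf]] := presentation_of_completion mk Is iso.
have [regs' _] := regular_sequence_on regs.
have [S' [n' [g [f' [regn' f'surj kerf']]]]] :=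
  regular_presentation_reduce maxm triv regn fsurj regs' kerf.
have [I' [I'g iso']] := completion_of_presentation mk f'surj kerf'.
by exists S', n', g, I'.
Qed.
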